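(* Let $P\in\{\text{open},\text{semi-open},\text{closed}\}$ denote a type of fractional annuli. Then the map $\Phi$ that sends a fractional annulus $V_{\alpha,\beta}$ over $K$ of radii $|\pi|^\beta<|\pi|^\alpha$ to the pair $(\beta-\alpha,\overline\alpha)\in\mathbb Q_{>0}\times\mathbb Q/\mathbb Z$ induces a bijection $$\Phi\colon\big\{\text{isomorphism classes of fractional annuli of type }P\text{ over }K\big\}\;\xrightarrow{\ \sim\ }\;\big(\mathbb Q_{>0}\times\mathbb Q/\mathbb Z\big)\big/\!\sim_P,$$ where $\sim_P$ is the equivalence relation on $\mathbb Q_{>0}\times\mathbb Q/\mathbb Z$ generated by the relations of the form $(a,b)\sim_P(a,a-b)$ if $P\in\{\text{open},\text{closed}\}$, while $\sim_{\text{semi-open}}$ is the trivial equivalence relation.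
   Context: $K$ is a field complete with respect to a nontrivial discrete valuation, $R$ its valuation ring and $\pi$ a uniformizer of $R$. $K$-analytic spaces are non-archimedean analytic spaces over $K$ (Berkovich or rigid), and isomorphisms are isomorphisms over $K$. For rational numbers $\alpha<\beta$, a fractional open (resp. semi-open, resp. closed) annulus $V_{\alpha,\beta}$ of radii $|\pi|^\beta<|\pi|^\alpha$ is a $K$-analytic space isomorphic to the subspace of the analytic affine line $\mathbb A^{1,\mathrm{an}}_K$ with coordinate $X$ defined by $|\pi|^\beta<|X|<|\pi|^\alpha$ (resp. $|\pi|^\beta<|X|\le|\pi|^\alpha$, resp. $|\pi|^\beta\le|X|\le|\pi|^\alpha$). The rational number $\beta-\alpha$ is called the modulus of $V_{\alpha,\beta}$, and $\overline\alpha$ denotes the class of $\alpha$ in $\mathbb Q/\mathbb Z$.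
   Formalization: For open and closed annuli the generating relation is (a,b) ~ (a,-a-b) instead of the printed (a,a-b); the printed one fails, since X -> 1/X identifies V_{0,1/3} with V_{-1/3,0}, whose pairs (1/3,0) and (1/3,2/3) it does not relate. *)

(* Defs.v *)
From HB Require Import structures.
From mathcomp Require Import all_boot all_order all_algebra.
From mathcomp Require Import all_classical all_reals all_analysis.
From mathcomp Require Import ring.
From Stdlib Require Import Relation_Operators.

Set Implicit Arguments.
Unset Strict Implicit.
Unset Printing Implicit Defensive.

Import Order.TTheory GRing.Theory Num.Theory.
Local Open Scope classical_set_scope.
Local Open Scope ring_scope.

Record absval (R : realType) (F : fieldType) := AbsVal {
  av_fun :> F -> R;
  av_ge0 : forall x, 0 <= av_fun x;
  av_eq0 : forall x, av_fun x = 0 <-> x = 0;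
  av_mul : forall x y, av_fun (x * y) = av_fun x * av_fun y;
  av_add : forall x y, av_fun (x + y) <= Num.max (av_fun x) (av_fun y)
}.

(* The value group is the infinite cyclic group generated by |pi|; the
   existence of such a pi says that v is discrete and nontrivial. *)
Definition is_uniformizer (R : realType) (F : fieldType) (v : absval R F)
    (pi : F) : Prop :=
  0 < v pi < 1 /\ forall x, x != 0 -> exists n : int, v x = v pi ^ n.

Definition complete_absval (R : realType) (F : fieldType) (v : absval R F) :
    Prop :=
  forall u : nat -> F,
    (forall e : R, 0 < e ->
       exists N, forall m n, (N <= m)%N -> (N <= n)%N -> v (u m - u n) < e) ->
    exists l : F, forall e : R, 0 < e ->
       exists N, forall n, (N <= n)%N -> v (u n - l) < e.

(* The fixed algebraic closure of K; when K is complete it carries exactly one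
   absolute value extending that of K. *)
Definition is_valued_closure (R : realType) (K : fieldType)
    (L : closedFieldType) (iota : {rmorphism K -> L})
    (vK : absval R K) (vL : absval R L) : Prop :=
  (forall x : L, algebraicOver iota x) /\ (forall a : K, vL (iota a) = vK a).

(* A set of points with admissible opens, admissible coverings and a presheaf
   of K-algebras.  Rigid K-analytic spaces are the objects of this kind that
   are moreover G-topological spaces with a sheaf, locally isomorphic to
   affinoid spaces.  These conditions are invariant under isomorphism, and an
   isomorphism of rigid spaces is exactly an isomorphism of the underlying
   G-ringed K-spaces (locality on stalks is automatic), so leaving them out of
   the record does not change which objects are annuli nor when two of them
   are isomorphic. *)
Record gspace (K : fieldType) := GSpace {
  gpoint :> Type;
  gopen : set gpoint -> Prop;
  gcover : set gpoint -> set (set gpoint) -> Prop;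
  gsec : {U : set gpoint | gopen U} -> comPzRingType;
  gscal : forall U, {rmorphism K -> gsec U};
  gres : forall U V, sval V `<=` sval U -> {rmorphism gsec U -> gsec V};
  gres_scal : forall U V (h : sval V `<=` sval U) a,
    gres h (gscal U a) = gscal V a;
  gres_id : forall U (h : sval U `<=` sval U) s, gres h s = s;
  gres_comp : forall U V W (h : sval V `<=` sval U) (h' : sval W `<=` sval V)
      (h'' : sval W `<=` sval U) s,
    gres h' (gres h s) = gres h'' s
}.

Section Isomorphisms.
Variable K : fieldType.
Implicit Types X Y : gspace K.

Definition gopens X := {U : set X | gopen U}.

Definition gpreim X Y (f : X -> Y)
    (fo : forall U, gopen U -> gopen (f @^-1` U)) (U : gopens Y) : gopens X :=
  exist _ (f @^-1` sval U) (fo _ (svalP U)).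

Lemma gpreim_sub X Y (f : X -> Y)
    (fo : forall U, gopen U -> gopen (f @^-1` U)) (U V : gopens Y) :
  sval V `<=` sval U -> sval (gpreim fo V) `<=` sval (gpreim fo U).
Proof. by move=> h x; apply: h. Qed.

Record gmorphism X Y := GMorphism {
  gfun :> X -> Y;
  gfun_open : forall U, gopen U -> gopen (gfun @^-1` U);
  gfun_cover : forall U C, gcover U C ->
    gcover (gfun @^-1` U) [set gfun @^-1` V | V in C];
  gpull : forall U : gopens Y, {rmorphism gsec U -> gsec (gpreim gfun_open U)};
  gpull_scal : forall U a, gpull U (gscal U a) = gscal (gpreim gfun_open U) a;
  gpull_res : forall (U V : gopens Y) (h : sval V `<=` sval U) s,
    gpull V (gres h s) = gres (gpreim_sub h) (gpull U s)
}.

Definition is_giso X Y (f : gmorphism X Y) : Prop :=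
  [/\ bijective f,
      forall U : set Y, gopen (f @^-1` U) -> gopen U,
      forall (U : set Y) (C : set (set Y)),
        gcover (f @^-1` U) [set f @^-1` V | V in C] -> gcover U C &
      forall U : gopens Y, bijective (gpull f U)].

Definition giso X Y : Prop := exists f : gmorphism X Y, is_giso f.

End Isomorphisms.

(* Maximal ideals of K[X], given by their monic generators. *)
Definition closed_point (K : fieldType) : Type :=
  {p : {poly K} | p \is monic /\ irreducible_poly p}.

Section AffineLine.
Variables (R : realType) (K : fieldType) (L : closedFieldType).
Variables (iota : {rmorphism K -> L}) (v : absval R L).
Implicit Types (A U Z : set (closed_point K)) (x : L).

(* the value at x of a polynomial over K *)
Definition pval (g : {poly K}) x : L := (map_poly iota g).[x].

Definition lies_over A x : Prop := exists2 p, A p & pval (sval p) x = 0.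

Definition cut_out (C : L -> Prop) : set (closed_point K) :=
  [set p | forall x, pval (sval p) x = 0 -> C x].

(* Intersections of finitely many rational subdomains |g| <= |h| of a closed
   disc |X| <= |c|.  Every affinoid subdomain of the line is a finite union of
   these (Gerritzen-Grauert). *)
Definition rational_domain Z : Prop :=
  exists (c : K) (s : seq ({poly K} * {poly K})),
    [/\ c != 0,
        forall gh, gh \in s -> coprimep gh.1 gh.2 &
        Z = cut_out (fun x => v x <= v (iota c) /\
              forall gh, gh \in s -> v (pval gh.1 x) <= v (pval gh.2 x))].

(* On a curve every union of affinoid subdomains is admissible; a covering is
   admissible when its trace on each affinoid subdomain has a finite affinoid
   refinement. *)
Definition admissible_open U : Prop :=
  forall p, U p -> exists Z, [/\ rational_domain Z, Z `<=` U & Z p].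

Definition admissible_cover U (C : set (set (closed_point K))) : Prop :=
  [/\ forall V, C V -> admissible_open V,
      U = \bigcup_(V in C) V &
      forall Z, rational_domain Z -> Z `<=` U ->
        exists s : seq (set (closed_point K)),
          (forall W, W \in s ->
             rational_domain W /\ exists2 V, C V & W `<=` V) /\
          Z `<=` [set p | exists2 W, W \in s & W p]].

(* The line is reduced, so an analytic function on U is determined by its
   values at the geometric points over U. *)
Definition geom U : Type := {x : L | lies_over U x}.

(* The affinoid algebra of Z is the closure of the rational functions over K
   without poles on Z in the Banach algebra of bounded functions on Z. *)
Definition analytic_on Z U (f : geom U -> L) : Prop :=
  (exists M : R, forall y, lies_over Z (sval y) -> v (f y) <= M) /\
  (forall e : R, 0 < e -> exists g h : {poly K},
     forall y, lies_over Z (sval y) ->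
       pval h (sval y) != 0 /\
       v (f y - pval g (sval y) / pval h (sval y)) <= e).

(* O(U) is the limit of O(Z) over the affinoid subdomains Z of U. *)
Definition analytic U (f : geom U -> L) : Prop :=
  forall Z, rational_domain Z -> Z `<=` U -> analytic_on Z f.

Definition analytic_pred U : {pred (geom U -> L)} :=
  fun f => `[< analytic f >].
#[global] Arguments analytic_pred : clear implicits.

Lemma pvalC a x : pval a%:P x = iota a.
Proof. by rewrite /pval map_polyC hornerC. Qed.

Lemma pvalB g h x : pval (g - h) x = pval g x - pval h x.
Proof. by rewrite /pval rmorphB hornerD hornerN. Qed.

Lemma pvalM g h x : pval (g * h) x = pval g x * pval h x.
Proof. by rewrite /pval rmorphM hornerM. Qed.

Lemma absval0 : v 0 = 0.
Proof. by apply/av_eq0. Qed.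

Lemma absval1 : v 1 = 1.
Proof.
have h : v 1 * v 1 = v 1 by rewrite -av_mul mulr1.
have n0 : v 1 != 0 by apply/eqP => /av_eq0/eqP; rewrite oner_eq0.
by apply: (mulfI n0); rewrite h mulr1.
Qed.

Lemma absvalN x : v (- x) = v x.
Proof.
have h : v (-1) = 1.
  have h1 : v (-1) ^+ 2 = 1 by rewrite expr2 -av_mul mulrNN mulr1 absval1.
  by apply/eqP; rewrite -(@pexpr_eq1 _ _ 2) ?av_ge0 // h1.
by rewrite -mulN1r av_mul h mul1r.
Qed.

Lemma analytic_cst U (a : K) : @analytic U (fun=> iota a).
Proof.
move=> Z _ _; split; first by exists (v (iota a)).
move=> e e0; exists a%:P, 1%:P => y _.
rewrite !pvalC rmorph1 oner_eq0 divr1 subrr absval0; split=> //.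
exact: ltW.
Qed.

Lemma analyticB U (f g : geom U -> L) :
  analytic f -> analytic g -> analytic (f - g).
Proof.
move=> fa ga Z hZ ZU; have [[M fM] fe] := fa Z hZ ZU.
have [[N gN] ge] := ga Z hZ ZU; split.
  exists (Num.max M N) => y hy; apply: (le_trans (av_add v _ _)).
  by rewrite absvalN ge_max !le_max fM // gN // orbT.
move=> e e0; have [g1 [h1 H1]] := fe e e0; have [g2 [h2 H2]] := ge e e0.
exists (g1 * h2 - g2 * h1), (h1 * h2) => y hy.
have [n1 b1] := H1 y hy; have [n2 b2] := H2 y hy.
rewrite pvalB !pvalM mulf_neq0 //; split=> //.
have -> : (f - g) y = f y - g y by [].
have -> : f y - g y - (pval g1 (sval y) * pval h2 (sval y)
      - pval g2 (sval y) * pval h1 (sval y)) /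
      (pval h1 (sval y) * pval h2 (sval y)) =
    (f y - pval g1 (sval y) / pval h1 (sval y))
    - (g y - pval g2 (sval y) / pval h2 (sval y)).
  by field; rewrite n1 n2.
by apply: (le_trans (av_add v _ _)); rewrite absvalN ge_max b1 b2.
Qed.

Lemma analyticM U (f g : geom U -> L) :
  analytic f -> analytic g -> analytic (f * g).
Proof.
move=> fa ga Z hZ ZU; have [[M fM] fe] := fa Z hZ ZU.
have [[N gN] ge] := ga Z hZ ZU.
pose B := Num.max 1 (Num.max M N).
have B0 : 0 < B by rewrite lt_max ltr01.
have fB y : lies_over Z (sval y) -> v (f y) <= B.
  by move=> hy; rewrite !le_max fM // orbT.
have gB y : lies_over Z (sval y) -> v (g y) <= B.
  by move=> hy; rewrite !le_max gN // !orbT.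
split.
  exists (B * B) => y hy; rewrite [(f * g) y]/(f y * g y) av_mul.
  by apply: ler_pM; rewrite ?av_ge0 ?fB ?gB.
move=> e e0; pose d := Num.min B (e / B).
have d0 : 0 < d by rewrite lt_min B0 divr_gt0.
have [g1 [h1 H1]] := fe d d0; have [g2 [h2 H2]] := ge d d0.
exists (g1 * g2), (h1 * h2) => y hy.
have [n1 b1] := H1 y hy; have [n2 b2] := H2 y hy.
rewrite !pvalM mulf_neq0 //; split=> //.
set r1 := pval g1 (sval y) / _ in b1; set r2 := pval g2 (sval y) / _ in b2.
have r1B : v r1 <= B.
  have -> : r1 = f y - (f y - r1) by rewrite subKr.
  apply: (le_trans (av_add v _ _)); rewrite absvalN ge_max fB //.
  by apply: le_trans b1 _; rewrite ge_min lexx.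
have dB : d * B <= e.
  by rewrite -ler_pdivlMr // ge_min lexx orbT.
have -> : (f * g) y - pval g1 (sval y) * pval g2 (sval y) /
      (pval h1 (sval y) * pval h2 (sval y)) =
    (f y - r1) * g y + r1 * (g y - r2).
  have -> : (f * g) y = f y * g y by [].
  by rewrite /r1 /r2; field; rewrite n1 n2.
apply: (le_trans (av_add v _ _)); rewrite (av_mul v (f y - r1)) (av_mul v r1) ge_max.
apply/andP; split; apply: le_trans dB.
  by rewrite ler_pM ?av_ge0 ?gB.
by rewrite mulrC ler_pM ?av_ge0.
Qed.

Lemma analytic_subring U : subring_closed (analytic_pred U).
Proof.
split.
- apply/asboolP; have := @analytic_cst U 1.
  by rewrite rmorph1.
- by move=> f g /asboolP fa /asboolP ga; apply/asboolP/analyticB.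
- by move=> f g /asboolP fa /asboolP ga; apply/asboolP/analyticM.
Qed.

HB.instance Definition _ U :=
  GRing.isSubringClosed.Build (geom U -> L) (analytic_pred U)
    (@analytic_subring U).

Record afun U := AFun {
  afun_val :> geom U -> L;
  afun_analytic : afun_val \in analytic_pred U
}.

HB.instance Definition _ U := [isSub for @afun_val U].
HB.instance Definition _ U := [Choice of afun U by <:].
HB.instance Definition _ U :=
  GRing.SubChoice_isSubComPzRing.Build (geom U -> L) (analytic_pred U) (afun U)
    (@analytic_subring U).

Definition afun_cst U (a : K) : afun U :=
  AFun (introT (asboolP _) (analytic_cst a)).

Lemma afun_cst_is_zmod U : zmod_morphism (@afun_cst U).
Proof.
by move=> a b; apply/val_inj/funext => y; rewrite raddfB /= rmorphB.
Qed.

Lemma afun_cst_is_monoid U : monoid_morphism (@afun_cst U).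
Proof.
split; first by apply/val_inj/funext => y; rewrite /= rmorph1.
by move=> a b; apply/val_inj/funext => y /=; rewrite rmorphM.
Qed.

HB.instance Definition _ U :=
  GRing.isZmodMorphism.Build K (afun U) (@afun_cst U)
    (@afun_cst_is_zmod U).
HB.instance Definition _ U :=
  GRing.isMonoidMorphism.Build K (afun U) (@afun_cst U)
    (@afun_cst_is_monoid U).

Definition geom_incl U V (VU : V `<=` U) (y : geom V) : geom U :=
  exist _ (sval y)
    (let: ex_intro2 p Vp py := svalP y in ex_intro2 _ _ p (VU p Vp) py).

Lemma restr_analytic U V (VU : V `<=` U) (s : afun U) :
  (s \o geom_incl VU) \in analytic_pred V.
Proof.
apply/asboolP => Z hZ ZV.
have /asboolP/(_ Z hZ (subset_trans ZV VU)) [[M sM] se] := afun_analytic s.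
split; first by exists M => y hy; apply: sM.
by move=> e /se [g [h H]]; exists g, h => y hy; apply: (H (geom_incl VU y)).
Qed.

Definition restr U V (VU : V `<=` U) (s : afun U) : afun V :=
  AFun (restr_analytic VU s).

Lemma restr_is_zmod U V (VU : V `<=` U) : zmod_morphism (restr VU).
Proof. by move=> s t; apply/val_inj. Qed.

Lemma restr_is_monoid U V (VU : V `<=` U) : monoid_morphism (restr VU).
Proof. by split=> [|s t]; apply/val_inj. Qed.

HB.instance Definition _ U V (VU : V `<=` U) :=
  GRing.isZmodMorphism.Build (afun U) (afun V) (restr VU)
    (restr_is_zmod VU).
HB.instance Definition _ U V (VU : V `<=` U) :=
  GRing.isMonoidMorphism.Build (afun U) (afun V) (restr VU)
    (restr_is_monoid VU).

Section Subspace.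
Variable S : set (closed_point K).

Definition sub_point : Type := {p : closed_point K | S p}.

Definition sub_image (U : set sub_point) : set (closed_point K) :=
  [set sval p | p in U].

Definition sub_open (U : set sub_point) : Prop := admissible_open (sub_image U).

Definition sub_cover (U : set sub_point) (C : set (set sub_point)) : Prop :=
  admissible_cover (sub_image U) [set sub_image V | V in C].

Definition sub_opens : Type := {U : set sub_point | sub_open U}.

Definition sub_sec (U : sub_opens) : comPzRingType :=
  afun (sub_image (sval U)).

Definition sub_scal (U : sub_opens) :
    {rmorphism K -> sub_sec U} :=
  @afun_cst (sub_image (sval U)).

Definition sub_res (U V : sub_opens)
    (VU : sval V `<=` sval U) : {rmorphism sub_sec U -> sub_sec V} :=
  restr (image_subset (@sval _ _) VU).

Lemma sub_res_scal (U V : sub_opens) (h : sval V `<=` sval U) a :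
  sub_res h (sub_scal U a) = sub_scal V a.
Proof. exact/val_inj. Qed.

Lemma sub_res_id (U : sub_opens) (h : sval U `<=` sval U) s : sub_res h s = s.
Proof.
apply/val_inj/funext => y /=; congr (afun_val s _).
by case: y => x hx; rewrite /geom_incl /=; congr exist; apply: Prop_irrelevance.
Qed.

Lemma sub_res_comp (U V W : sub_opens) (h : sval V `<=` sval U)
    (h' : sval W `<=` sval V)
    (h'' : sval W `<=` sval U) s :
  sub_res h' (sub_res h s) = sub_res h'' s.
Proof.
apply/val_inj/funext => y /=; congr (afun_val s _).
by rewrite /geom_incl /=; congr exist; apply: Prop_irrelevance.
Qed.

Definition subspace : gspace K :=
  GSpace sub_cover sub_res_scal sub_res_id sub_res_comp.

End Subspace.

Inductive annulus_type := OpenAnnulus | SemiOpenAnnulus | ClosedAnnulus.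

Variables (pi : K) (P : annulus_type).

Definition radius (a : rat) : R := v (iota pi) `^ ratr a.

(* The condition on t = |X|; the outer radius is the one with exponent alpha. *)
Definition in_annulus (alpha beta : rat) (t : R) : Prop :=
  match P with
  | OpenAnnulus => radius beta < t < radius alpha
  | SemiOpenAnnulus => radius beta < t <= radius alpha
  | ClosedAnnulus => radius beta <= t <= radius alpha
  end.

Definition std_annulus (alpha beta : rat) : gspace K :=
  subspace (cut_out (fun x => in_annulus alpha beta (v x))).

Definition is_annulus (alpha beta : rat) (V : gspace K) : Prop :=
  alpha < beta /\ giso V (std_annulus alpha beta).

Definition annulus_isoclass : Type :=
  {C : gspace K -> Prop |
    exists V, (exists alpha beta, is_annulus alpha beta V) /\ C = giso V}.

Definition isoclass_of V (hV : exists alpha beta, is_annulus alpha beta V) :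
    annulus_isoclass :=
  exist _ (giso V) (ex_intro _ V (conj hV erefl)).

End AffineLine.

Definition quotient (T : Type) (E : T -> T -> Prop) : Type :=
  {C : T -> Prop | exists t, C = E t}.

Definition class_of (T : Type) (E : T -> T -> Prop) (t : T) : quotient E :=
  exist _ (E t) (ex_intro _ t erefl).

Definition posQ : Type := {a : rat | 0 < a}.

Definition QmodZ : zmodType :=
  Quotient.quot (GRing.ZmodClosed.clone rat (@Num.int_num_subdef rat) _).

Definition QmodZ_class (a : rat) : QmodZ := \pi_QmodZ%qT a.

Definition modulus (alpha beta : rat) (h : alpha < beta) : posQ :=
  exist _ (beta - alpha) (etrans (subr_gt0 alpha beta) h).

(* X |-> 1/X maps the annulus (alpha, beta) onto (- beta, - alpha), of the same
   modulus a, and - beta = - a - alpha. *)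
Definition flip (x y : posQ * QmodZ) : Prop :=
  y = (x.1, - QmodZ_class (sval x.1) - x.2).

Definition annulus_equiv (P : annulus_type) :
    posQ * QmodZ -> posQ * QmodZ -> Prop :=
  match P with
  | SemiOpenAnnulus => eq
  | OpenAnnulus | ClosedAnnulus => clos_refl_sym_trans _ flip
  end.

(* Main.v *)
(* Conjugate elements of L over the complete field K have the same absolute value,
   so a closed point of the line has a radius |pi|^q with q
   rational.  On a closed annulus a unit is uniformly close to a rational function
   without zeros or poles there, and each irreducible polynomial without zeros in
   the annulus has all its roots inside or all outside; hence a unit has absolute
   value |c| |x|^m with c in K and m an integer.  A morphism f between annuli is
   determined on points by the pullback of the coordinate, which is a unit, so it
   acts on exponents of radii by q |-> n + m q.  For an isomorphism this holds in
   both directions, which forces m = 1 (translating alpha by n) or m = -1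
   (exchanging the two boundaries, so not possible for semi-open annuli).
   Conversely x |-> c / x realises the case m = -1, and composing two such maps
   realises the translations. *)

From HB Require Import structures.
Require Import Defs.
From mathcomp Require Import all_boot all_order all_algebra.
From mathcomp Require Import all_classical all_reals all_analysis.
From mathcomp Require Import ring lra.
From Stdlib Require Import Relation_Operators.

Set Implicit Arguments.
Unset Strict Implicit.
Unset Printing Implicit Defensive.

Import Order.TTheory GRing.Theory Num.Theory.
Local Open Scope classical_set_scope.
Local Open Scope ring_scope.

(** * Absolute values and conjugate elements *)

(** Only [K] is complete, so equality of the absolute values of conjugates [x] and [y] is derived
    from an equivalence of norms on the polynomial values at [x]: it gives
    [v y ^+ k <= C * v x ^+ k] with [C] independent of [k]. After that, statements about closed
    points are moved to elements of [L] through [pt]. Two obstacles shape the rest. An analytic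
    function on an open or semi-open annulus is controlled only on rational domains, hence on closed
    subannuli; the integers found on these agree because an affine function of the exponent is fixed
    by its values at two exponents. And [c / x] is not analytic at [0] and sends small discs to
    unbounded sets, so it is transported only on sets whose radii lie in a closed interval, where
    reversing polynomials carries rational domains to rational domains. That [m] is a sign comes
    from the moduli: an isomorphism multiplies the modulus by [|m|], its inverse by [|m'|], and the
    product of these positive integers is [1]. *)

Section AbsoluteValue.
Variables (R : realType) (F : fieldType) (v : absval R F).
Implicit Types x y : F.

Lemma absval_eq0 x : (v x == 0) = (x == 0).
Proof. by apply/eqP/eqP => /(av_eq0 v). Qed.

Lemma absval_gt0 x : (0 < v x) = (x != 0).
Proof. by rewrite lt_def av_ge0 andbT absval_eq0. Qed.

Lemma absval_is0 : v 0 = 0.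
Proof. by apply/av_eq0. Qed.

Lemma absval_is1 : v 1 = 1.
Proof.
have h : v 1 * v 1 = v 1 by rewrite -av_mul mulr1.
by apply: (@mulfI _ (v 1)); rewrite ?absval_eq0 ?oner_eq0 // h mulr1.
Qed.

Lemma absval_opp x : v (- x) = v x.
Proof.
have h : v (-1) = 1.
  have h1 : v (-1) ^+ 2 = 1 by rewrite expr2 -av_mul mulrNN mulr1 absval_is1.
  by apply/eqP; rewrite -(@pexpr_eq1 _ _ 2) ?av_ge0 // h1.
by rewrite -mulN1r av_mul h mul1r.
Qed.

Lemma absvalX x n : v (x ^+ n) = v x ^+ n.
Proof.
by elim: n => [|n IH]; rewrite ?expr0 ?absval_is1 // !exprS av_mul IH.
Qed.

Lemma absvalV x : v x^-1 = (v x)^-1.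
Proof.
have [->|x0] := eqVneq x 0; first by rewrite invr0 absval_is0 invr0.
apply: (@mulfI _ (v x)); rewrite ?absval_eq0 // -av_mul divff //.
by rewrite divff ?absval_is1 // absval_eq0.
Qed.

Lemma absvalXz x (n : int) : v (x ^ n) = v x ^ n.
Proof.
by case: n => n; rewrite ?NegzE -?exprnN ?absvalV absvalX.
Qed.

Lemma absval_sub x y : v (x - y) <= Num.max (v x) (v y).
Proof. by rewrite -(absval_opp y) av_add. Qed.

Lemma absval_le_add x y e : v x <= e -> v y <= e -> v (x + y) <= e.
Proof. by move=> hx hy; apply: le_trans (av_add _ _ _) _; rewrite ge_max hx. Qed.

Lemma absval_le_sub x y e : v x <= e -> v y <= e -> v (x - y) <= e.
Proof. by move=> hx hy; apply: absval_le_add; rewrite ?absval_opp. Qed.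

Lemma absval_addl x y : v y < v x -> v (x + y) = v x.
Proof.
move=> yx; apply/eqP; rewrite eq_le; apply/andP; split.
  by apply: le_trans (av_add _ _ _) _; rewrite ge_max lexx ltW.
have : v x <= Num.max (v (x + y)) (v y).
  by rewrite -{1}(addrK y x) absval_sub.
by rewrite le_max [v x <= v y]leNgt yx orbF.
Qed.

Lemma absval_subl x y : v y < v x -> v (x - y) = v x.
Proof. by move=> yx; rewrite absval_addl ?absval_opp. Qed.

Lemma absval_subr x y : v x < v y -> v (x - y) = v y.
Proof. by move=> xy; rewrite -absval_opp opprB absval_subl. Qed.

Lemma absval_le_sum (I : Type) (s : seq I) (P : pred I) (f : I -> F) e :
  0 <= e -> (forall i, P i -> v (f i) <= e) -> v (\sum_(i <- s | P i) f i) <= e.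
Proof.
move=> e0 fe; elim/big_rec: _ => [|i x Pi IH]; first by rewrite absval_is0.
by apply: absval_le_add => //; apply: fe.
Qed.

Lemma absval_prod (I : Type) (s : seq I) (P : pred I) (f : I -> F) :
  v (\prod_(i <- s | P i) f i) = \prod_(i <- s | P i) v (f i).
Proof.
by apply: (big_morph v) => [x y|]; rewrite ?av_mul ?absval_is1.
Qed.

End AbsoluteValue.

Section Evaluation.
Variables (K : fieldType) (L : closedFieldType) (iota : {rmorphism K -> L}).
Local Notation pval := (pval iota).
Implicit Types (g h : {poly K}) (x : L).

Lemma pvalD g h x : pval (g + h) x = pval g x + pval h x.
Proof. by rewrite /pval rmorphD hornerD. Qed.

Lemma pvalZ a g x : pval (a *: g) x = iota a * pval g x.
Proof. by rewrite /pval map_polyZ hornerZ. Qed.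

Lemma pvalX x : pval 'X x = x.
Proof. by rewrite /pval map_polyX hornerX. Qed.

Lemma pvalXn n x : pval 'X^n x = x ^+ n.
Proof. by rewrite /pval map_polyXn hornerXn. Qed.

Lemma pval0 x : pval 0 x = 0.
Proof. by rewrite /pval map_poly0 horner0. Qed.

Lemma pval1 x : pval 1 x = 1.
Proof. by rewrite /pval rmorph1 hornerC. Qed.

Lemma pval_comp g h x : pval (g \Po h) x = pval g (pval h x).
Proof. by rewrite /pval map_comp_poly horner_comp. Qed.

Lemma pval_coefE n g x : (size g <= n)%N ->
  pval g x = \sum_(i < n) iota g`_i * x ^+ i.
Proof.
move=> sg; rewrite /pval (@horner_coef_wide _ n) ?size_map_poly //.
by apply: eq_bigr => i _; rewrite coef_map.
Qed.

Lemma pval_dvdp g h x : g %| h -> pval g x = 0 -> pval h x = 0.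
Proof. by move=> /dvdpP[q ->] g0; rewrite pvalM g0 mulr0. Qed.

(** If [g] did not divide [h] they would be coprime, and a Bezout identity evaluated at the common
    root would read [0 = 1]. *)
Lemma irreducible_dvdp g h x :
  irreducible_poly g -> pval g x = 0 -> pval h x = 0 -> g %| h.
Proof.
move=> gi g0 h0; apply: contraT; rewrite -irreducible_poly_coprime //.
move=> /Bezout_eq1_coprimepP[[a b] /= ab].
have := pval1 x; rewrite -ab pvalD !pvalM g0 h0 !mulr0 addr0 => /eqP.
by rewrite eq_sym oner_eq0.
Qed.

End Evaluation.

(** * Equivalence of norms on polynomial values, and conjugate elements *)

Section NormEquivalence.
Variables (R : realType) (K : fieldType) (vK : absval R K).
Hypothesis hK : complete_absval vK.
Variables (L : closedFieldType) (iota : {rmorphism K -> L}) (v : absval R L).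
Hypothesis ext : forall a, v (iota a) = vK a.
Local Notation pval := (pval iota).

Lemma pval_bound x n : exists2 M : R, 0 <= M &
  forall (g : {poly K}) e, (size g <= n)%N -> 0 <= e ->
    (forall i, vK g`_i <= e) ->
    v (pval g x) <= e * M.
Proof.
exists (\sum_(i < n) v x ^+ i).
  by apply: sumr_ge0 => i _; rewrite exprn_ge0 ?av_ge0.
move=> g e sg e0 ge; rewrite (pval_coefE _ _ sg).
have M0 : 0 <= \sum_(i < n) v x ^+ i.
  by apply: sumr_ge0 => i _; rewrite exprn_ge0 ?av_ge0.
apply: absval_le_sum => [|i _]; first by rewrite mulr_ge0.
rewrite av_mul ext absvalX ler_pM ?av_ge0 ?exprn_ge0 ?av_ge0 //.
by rewrite (bigD1 i) //= lerDl sumr_ge0 // => j _; rewrite exprn_ge0 ?av_ge0.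
Qed.

(* The values at [x] of the polynomials of size at most [n] form a complete,
   hence closed, subspace of [L]. *)
Lemma dist_monomial x n c :
  (forall g : {poly K}, (size g <= n.+1)%N -> pval g x = 0 -> g = 0) ->
  0 < c ->
  (forall g : {poly K}, (size g <= n)%N ->
    forall i, c * vK g`_i <= v (pval g x)) ->
  exists2 d : R, 0 < d &
    forall g : {poly K}, (size g <= n)%N -> d <= v (pval ('X^n - g) x).
Proof.
move=> inj c0 IH; apply: contrapT => nd.
have /choice[u uP] : forall k : nat, exists g : {poly K},
    (size g <= n)%N /\ v (pval ('X^n - g) x) < k.+1%:R^-1.
  move=> k; apply: contrapT => h; apply: nd; exists k.+1%:R^-1.
    by rewrite invr_gt0 ltr0n.
  by move=> g sg; rewrite leNgt; apply/negP => hg; apply: h; exists g.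
have small (e : R) : 0 < e -> exists N : nat, forall k, (N <= k)%N ->
    v (pval ('X^n - u k) x) < e.
  move=> e0; exists (Num.trunc e^-1) => k hk; apply: lt_le_trans (uP k).2 _.
  rewrite -[leRHS]invrK lef_pV2 ?posrE ?invr_gt0 ?ltr0n //.
  by apply/ltW/(lt_le_trans (truncnS_gt _)); rewrite ler_nat.
(* The approximants [u k] are Cauchy in value, hence coefficientwise by [IH]; completeness of [K]
   gives a limit polynomial whose value at [x] is [x ^+ n], against [inj]. *)
have /choice[l lP] : forall i : nat, exists a : K, forall e : R, 0 < e ->
    exists N, forall k, (N <= k)%N -> vK ((u k)`_i - a) < e.
  move=> i; apply: hK => e e0.
  have [N NP] := small (c * e) (mulr_gt0 c0 e0); exists N => j k hj hk.
  rewrite -(ltr_pM2l c0) -coefB; apply: le_lt_trans (IH _ _ _) _.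
    by rewrite (leq_trans (size_polyD _ _)) // size_polyN geq_max !(uP _).1.
  have -> : u j - u k = ('X^n - u k) - ('X^n - u j) by ring.
  by rewrite pvalB; apply: le_lt_trans (absval_sub _ _ _) _; rewrite gt_max !NP.
pose g := \poly_(i < n) l i.
have sg : (size g <= n)%N by apply: size_poly.
have [M M0 MP] := pval_bound x n.
suff g0 : pval ('X^n - g) x = 0.
  have := inj _ _ g0; rewrite (leq_trans (size_polyD _ _)); last first.
    by rewrite size_polyN geq_max size_polyXn leqnn leqW.
  move=> /(_ isT)/polyP/(_ n)/eqP.
  by rewrite coefB coefXn eqxx (nth_default _ sg) subr0 coef0 oner_eq0.
apply/eqP; rewrite -(absval_eq0 v) eq_le av_ge0 andbT.
apply/ler_addgt0Pr => e e0; rewrite add0r.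
have [N1 N1P] := small e e0.
(* The [+ 1] covers the case [M = 0]. *)
pose e' := e / (M + 1).
have M1 : 0 < M + 1 by rewrite ltr_wpDl.
have e'0 : 0 < e' by rewrite divr_gt0.
have /choice[N NP] : forall i : nat, exists N : nat, forall k, (N <= k)%N ->
  vK ((u k)`_i - l i) < e' by move=> i; apply: lP.
pose k := maxn N1 (\max_(i < n) N i).
have -> : 'X^n - g = ('X^n - u k) + (u k - g) by ring.
rewrite pvalD; apply: absval_le_add.
  by rewrite ltW // N1P // leq_maxl.
apply: (@le_trans _ _ (e' * M)).
  apply: MP; rewrite ?(ltW e'0) //.
    by rewrite (leq_trans (size_polyD _ _)) // size_polyN geq_max (uP k).1.
  move=> i; rewrite coefB coef_poly; case: ltnP => hi; last first.
    by rewrite nth_default ?subrr ?absval_is0 ?ltW // (leq_trans (uP k).1).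
  apply/ltW/NP; rewrite leq_max; apply/orP; right.
  exact: (@leq_bigmax _ (fun i : 'I_n => N i) (Ordinal hi)).
by rewrite /e' mulrAC ler_pdivrMr // ler_pM2l // lerDl.
Qed.

(** Induction on [n]: the coefficient of ['X^n] is controlled by the distance from [x ^+ n] to the
    values of shorter polynomials, and the remaining ones by the bound for [n] applied after
    subtracting the top term. *)
Lemma coef_bound x n :
  (forall g : {poly K}, (size g <= n)%N -> pval g x = 0 -> g = 0) ->
  exists2 c : R, 0 < c &
    forall g : {poly K}, (size g <= n)%N -> forall i, c * vK g`_i <= v (pval g x).
Proof.
elim: n => [|n IH] inj.
  exists 1 => // g; rewrite leqn0 size_poly_eq0 => /eqP-> i.
  by rewrite coef0 absval_is0 mulr0 av_ge0.
have {IH}[g sg|c c0 cP] := IH; first by apply: inj; apply: leqW.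
have [d d0 dP] := dist_monomial inj c0 cP.
(* Removing the top term multiplies the value by at most [B]: by [top], the term itself has value at
   most [v (pval f x) * (v x ^+ n / d)]. *)
pose B := Num.max 1 (v x ^+ n / d).
have B0 : 0 < B by rewrite lt_max ltr01.
exists (Num.min d (c / B)) => [|f sf i]; first by rewrite lt_min d0 divr_gt0.
pose a := f`_n; pose g := f - a *: 'X^n.
have gn : g`_n = 0 by rewrite coefB coefZ coefXn eqxx mulr1 subrr.
have sg : (size g <= n)%N.
  apply/leq_sizeP => j; rewrite leq_eqVlt => /orP[/eqP<- //|nj].
  rewrite coefB coefZ coefXn gtn_eqF // mulr0 subr0.
  by rewrite nth_default // (leq_trans sf).
have fE : f = a *: 'X^n + g by rewrite /g; ring.
have top : d * vK a <= v (pval f x).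
  have [->|a0] := eqVneq a 0; first by rewrite absval_is0 mulr0 av_ge0.
  have -> : f = a *: ('X^n - - (a^-1 *: g)).
    by rewrite opprK scalerDr scalerA divff // scale1r.
  rewrite pvalZ av_mul ext mulrC ler_wpM2l ?av_ge0 // dP // size_polyN.
  by rewrite size_scale ?invr_eq0.
have [ni|] := eqVneq i n.
  rewrite ni; apply: le_trans top.
  by rewrite ler_wpM2r ?av_ge0 // ge_min lexx.
move=> i_n; have -> : f`_i = g`_i.
  by rewrite coefB coefZ coefXn (negPf i_n) mulr0 subr0.
apply: (@le_trans _ _ (c / B * vK g`_i)).
  by rewrite ler_wpM2r ?av_ge0 // ge_min lexx orbT.
rewrite mulrAC ler_pdivrMr //; apply: (le_trans (cP _ sg i)).
rewrite pvalB; apply: absval_le_sub.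
  by rewrite ler_peMr ?av_ge0 // le_max lexx.
rewrite pvalZ pvalXn av_mul ext absvalX.
apply: (@le_trans _ _ (v (pval f x) * (v x ^+ n / d))).
  rewrite mulrA ler_pdivlMr // mulrAC ler_wpM2r ?exprn_ge0 ?av_ge0 //.
  by rewrite mulrC.
by rewrite ler_wpM2l ?av_ge0 // le_max lexx orbT.
Qed.

(** Both [x ^+ k] and [y ^+ k] are values of the same remainder of ['X^k] modulo [p]. Its
    coefficients are at most [v x ^+ k / c], so [v y ^+ k <= v x ^+ k / c * M] for every [k], and
    letting [k] grow removes the constant. *)
Lemma conjugate_le (p : {poly K}) x y :
  irreducible_poly p -> pval p x = 0 -> pval p y = 0 -> v y <= v x.
Proof.
move=> pi px py; pose n := (size p).-1.
have sp : (1 < size p)%N by case: pi.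
have spn : size p = n.+1 by rewrite /n prednK // ltnW.
have [g sg gx|c c0 cP] := @coef_bound x n.
  apply/eqP/contraT => g0.
  have /dvdp_leq := irreducible_dvdp pi px gx.
  by move=> /(_ g0); rewrite spn ltnNge sg.
have [M M0 MP] := pval_bound y n.
have pow k : v y ^+ k <= v x ^+ k / c * M.
  have eqm z : pval p z = 0 -> z ^+ k = pval ('X^k %% p) z.
    move=> pz; rewrite -(pvalXn iota) {1}(divp_eq 'X^k p) pvalD pvalM pz.
    by rewrite mulr0 add0r.
  rewrite -!absvalX !eqm //.
  have sr : (size ('X^k %% p)%R <= n)%N.
    by rewrite -ltnS -spn ltn_modp irredp_neq0.
  apply: MP => // [|i]; first by rewrite divr_ge0 ?av_ge0 // ltW.
  by rewrite ler_pdivlMr // mulrC cP.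
have [x0|x0] := eqVneq (v x) 0.
  by have := pow 1%N; rewrite x0 !expr1 !mul0r.
have vx : 0 < v x by rewrite lt_def x0 av_ge0.
rewrite leNgt; apply/negP => xy.
pose r := v y / v x.
have r1 : 0 < r - 1 by rewrite subr_gt0 ltr_pdivlMr // mul1r.
have rpow k : r ^+ k <= M / c.
  rewrite expr_div_n ler_pdivrMr ?exprn_gt0 //.
  by apply: le_trans (pow k) _; rewrite -mulrA mulrC [c^-1 * _]mulrC.
(* Bernoulli's inequality makes the powers of [r > 1] unbounded, which contradicts [rpow]. *)
have bern k : 1 + k%:R * (r - 1) <= r ^+ k.
  elim: k => [|k IH]; first by rewrite mul0r addr0 expr0.
  rewrite exprS; apply: (@le_trans _ _ (r * (1 + k%:R * (r - 1)))).
    rewrite -subr_ge0; have -> : r * (1 + k%:R * (r - 1)) - (1 + k.+1%:R * (r - 1))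
      = k%:R * (r - 1) ^+ 2 by rewrite -natr1; ring.
    by rewrite mulr_ge0 // sqr_ge0.
  by rewrite ler_wpM2l // divr_ge0 ?av_ge0.
pose k := (Num.trunc (M / c / (r - 1))).+1.
have : M / c < k%:R * (r - 1) by rewrite -ltr_pdivrMr // truncnS_gt.
have := rpow k; have := bern k; lra.
Qed.

Lemma conjugate_eq (p : {poly K}) x y :
  irreducible_poly p -> pval p x = 0 -> pval p y = 0 -> v x = v y.
Proof. by move=> pi px py; apply/eqP; rewrite eq_le !(conjugate_le pi). Qed.

End NormEquivalence.

(** * Closed points and radii *)

Section ClosedPoints.
Variables (R : realType) (K : fieldType) (vK : absval R K).
Hypothesis hK : complete_absval vK.
Variables (L : closedFieldType) (iota : {rmorphism K -> L}) (v : absval R L).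
Hypothesis hL : is_valued_closure iota vK v.
Local Notation pval := (pval iota).

(** A nonzero annihilating polynomial of least size is irreducible; dividing by its leading
    coefficient makes it monic. *)
Lemma exists_point x : exists p : closed_point K, pval (sval p) x = 0.
Proof.
have [q q0 qx] := hL.1 x.
pose S n := `[< exists p : {poly K}, [/\ p != 0, pval p x = 0 & size p = n] >].
have [n /asboolP[p [p0 px pn]] min] := ex_minnP (ex_intro S (size q)
  (introT (asboolP _) (ex_intro _ q (And3 q0 (rootP qx) erefl)))).
have irr : irreducible_poly p.
  apply/(@fieldext.subfx_irreducibleP _ _ iota x) => //; first exact/rootP.
  move=> r rx r0; rewrite pn min //; apply/asboolP; exists r.
  by split=> //; apply/rootP.
have l0 : lead_coef p != 0 by rewrite lead_coef_eq0.
have pe : (lead_coef p)^-1 *: p %= p by rewrite eqp_scale ?invr_eq0.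
have mon : (lead_coef p)^-1 *: p \is monic.
  by rewrite monicE lead_coefZ mulVf.
have irr' : irreducible_poly ((lead_coef p)^-1 *: p).
  split=> [|r r1 rp]; first by rewrite size_scale ?invr_eq0 //; case: irr.
  rewrite (eqp_rtrans pe); case: irr => _; apply => //.
  by rewrite -(eqp_dvdr _ pe).
exists (exist (fun p : {poly K} => p \is monic /\ irreducible_poly p)
  _ (conj mon irr')).
by rewrite /= pvalZ px mulr0.
Qed.

(** The minimal polynomial of [x]. The choice is harmless by [pt_unique], and two elements have the
    same image exactly when they are conjugate. *)
Definition pt (x : L) : closed_point K := projT1 (cid (exists_point x)).

Lemma pt_root x : pval (sval (pt x)) x = 0.
Proof. exact: projT2 (cid (exists_point x)). Qed.

Lemma closed_point_inj (p q : closed_point K) : sval p = sval q -> p = q.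
Proof. by case: p q => p hp [q hq] /= pq; apply: eq_exist. Qed.

Lemma pt_unique (p : closed_point K) x : pval (sval p) x = 0 -> pt x = p.
Proof.
move=> px; apply: closed_point_inj; have := pt_root x.
case: (pt x) p px => q [/monicP mq iq] [p [/monicP mp ip]] /= px qx.
have pq : p %= q by rewrite /eqp !(irreducible_dvdp (x := x) (iota := iota)).
have [[a b] /andP[/= a0 b0] ab] := eqpP _ _ pq.
have := congr1 lead_coef ab; rewrite !lead_coefZ mp mq !mulr1 => E.
by move: ab; rewrite E => /(scalerI b0) ->.
Qed.

Lemma pt_eqP (x y : L) : pt x = pt y <-> pval (sval (pt x)) y = 0.
Proof.
split=> [->|]; first exact: pt_root.
by move/pt_unique.
Qed.

Lemma pt_surj p : exists x, pt x = p.
Proof.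
have [x /rootP px] : exists x, root (map_poly iota (sval p)) x.
  apply/closed_rootP; rewrite size_map_poly.
  by case: p => p [_ [sp _]] /=; rewrite gtn_eqF.
by exists x; apply: pt_unique.
Qed.

Lemma pval_eq0_pt g x y : pt x = pt y -> pval g x = 0 -> pval g y = 0.
Proof.
move=> /pt_eqP xy gx; apply: pval_dvdp xy.
have [_ irr] := svalP (pt x).
exact: irreducible_dvdp irr (pt_root x) gx.
Qed.

(** Composing the minimal polynomial of [g(x)] with [g] gives a polynomial that vanishes at [x],
    hence at its conjugate [y]. *)
Lemma pt_pval g x y : pt x = pt y -> pt (pval g x) = pt (pval g y).
Proof.
move=> xy; apply/pt_eqP; rewrite -pval_comp; apply: pval_eq0_pt xy _.
by rewrite pval_comp pt_root.
Qed.

Lemma absval_pt x y : pt x = pt y -> v x = v y.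
Proof.
move=> /pt_eqP xy; have [_ irr] := svalP (pt x).
exact: (conjugate_eq hK hL.2 irr (pt_root x) xy).
Qed.

Lemma absval_pval_pt g x y : pt x = pt y -> v (pval g x) = v (pval g y).
Proof. by move=> xy; apply/absval_pt/pt_pval. Qed.

Lemma lies_overE A x : lies_over iota A x <-> A (pt x).
Proof.
split=> [[p Ap /pt_unique -> //]|Ax]; exists (pt x) => //; exact: pt_root.
Qed.

(** [cut_out] quantifies over all roots of a closed point; for a condition invariant under
    conjugation a single root decides. *)
Lemma cut_outE (C : L -> Prop) x :
  (forall y z, pt y = pt z -> C y -> C z) ->
  cut_out iota C (pt x) <-> C x.
Proof.
move=> inv; split=> [|Cx y /pt_unique xy]; first by apply; apply: pt_root.
exact: inv Cx.
Qed.

Definition rational_cond (c : K) (s : seq ({poly K} * {poly K})) x : Prop :=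
  v x <= v (iota c) /\
  forall gh, gh \in s -> v (pval gh.1 x) <= v (pval gh.2 x).

Lemma rational_cond_pt c s x y :
  pt x = pt y -> rational_cond c s x -> rational_cond c s y.
Proof.
move=> xy [xc xs]; split=> [|gh /xs]; first by rewrite -(absval_pt xy).
by rewrite !(absval_pval_pt _ xy).
Qed.

Lemma rational_domainE Z : rational_domain iota v Z <->
  exists c s, [/\ c != 0, forall gh, gh \in s -> coprimep gh.1 gh.2 &
    forall x, Z (pt x) <-> rational_cond c s x].
Proof.
split=> -[c [s [c0 cs ZE]]]; exists c, s; split=> //.
  by move=> x; rewrite ZE; apply: cut_outE => y z; apply: rational_cond_pt.
apply/seteqP; split=> p; have [x <-] := pt_surj p.
  move=> /ZE H; apply/(cut_outE (C := rational_cond c s)) => //.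
  by move=> y z; apply: rational_cond_pt.
move=> /(cut_outE (C := rational_cond c s)) H; apply/ZE/H.
by move=> y z; apply: rational_cond_pt.
Qed.

End ClosedPoints.

(** * Exponents of absolute values *)

Section Radii.
Variables (R : realType) (K : fieldType) (vK : absval R K) (pi : K).
Hypotheses (hpi : is_uniformizer vK pi) (hK : complete_absval vK).
Variables (L : closedFieldType) (iota : {rmorphism K -> L}) (v : absval R L).
Hypothesis hL : is_valued_closure iota vK v.
Local Notation pval := (pval iota).
Local Notation rad := (Defs.radius iota v pi).
Local Notation pt := (pt hL).

Lemma uniformizer_lt1 : 0 < v (iota pi) < 1.
Proof. by rewrite hL.2; case: hpi. Qed.

Lemma rad_gt0 a : 0 < rad a.
Proof. by case/andP: uniformizer_lt1 => h _; apply: powR_gt0. Qed.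

Lemma radD a b : rad (a + b) = rad a * rad b.
Proof.
rewrite /Defs.radius raddfD powRD //; apply/implyP => _.
by case/andP: uniformizer_lt1 => h _; apply: lt0r_neq0.
Qed.

Lemma rad_int (n : int) : rad n%:~R = v (iota pi) ^ n.
Proof. by rewrite /Defs.radius ratr_int powR_intmul ?av_ge0. Qed.

Lemma radX a n : rad a ^+ n = rad (a * n%:R).
Proof.
by rewrite /Defs.radius rmorphM /= ratr_nat [RHS]powRrM powR_mulrn ?powR_ge0.
Qed.

Lemma rad_lt a b : (rad a < rad b) = (b < a).
Proof.
have mono c d : c < d -> rad d < rad c.
  case/andP: uniformizer_lt1 => h0 h1 cd; rewrite /Defs.radius.
  rewrite -[ltLHS]mul1r -ltr_pdivlMr ?powR_gt0 // -powRB; last first.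
    by rewrite (lt0r_neq0 h0) implybT.
  have -> : ratr c - ratr d = - ratr (d - c) :> R by rewrite rmorphB opprB.
  have dc : 0 < ratr (d - c) :> R by rewrite ltr0q subr_gt0.
  have := gt0_ltr_powR dc; rewrite powRN invf_gt1 ?powR_gt0 // => mono.
  by apply: lt_le_trans (mono _ _ _ _ h1) _; rewrite ?nnegrE ?av_ge0 ?powR1.
case: (ltgtP b a) => [/mono->//|/mono/ltW h|->]; last by rewrite ltxx.
by rewrite ltNge h.
Qed.

Lemma rad_le a b : (rad a <= rad b) = (b <= a).
Proof. by rewrite leNgt rad_lt -leNgt. Qed.

Lemma rad_inj : injective rad.
Proof.
by move=> a b ab; apply/eqP; rewrite eq_le -!rad_le ab lexx.
Qed.

Lemma base_value a : a != 0 -> exists n : int, v (iota a) = rad n%:~R.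
Proof.
by move=> a0; have [n an] := hpi.2 a a0; exists n; rewrite rad_int !hL.2.
Qed.

Lemma base_rad (n : int) : exists2 c : K, c != 0 & v (iota c) = rad n%:~R.
Proof.
exists (pi ^ n); last by rewrite rad_int !hL.2 absvalXz.
by rewrite expfz_neq0 // -(absval_gt0 vK); case: hpi => /andP[].
Qed.

Lemma irreducible_split (p : {poly K}) : p \is monic -> exists r : seq L,
  map_poly iota p = \prod_(z <- r) ('X - z%:P).
Proof.
move=> /monicP mp; have [r rE] := closed_field_poly_normal (map_poly iota p).
by exists r; rewrite rE lead_coef_map mp rmorph1 scale1r.
Qed.

(** All roots of the minimal polynomial have absolute value [v x], so its constant coefficient, an
    element of [K], has value [v x] to the power of the degree. The exponent is therefore an integer
    divided by the degree. *)
Lemma absval_rad x : x != 0 -> exists a, v x = rad a.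
Proof.
move=> x0; have [mon irr] := svalP (pt x); have xr := pt_root hL x.
set p := sval (pt x) in mon irr xr; have [r rE] := irreducible_split mon.
have vr z : z \in r -> v z = v x.
  move=> zr; apply: (absval_pt hK (hL := hL)); apply/esym/pt_eqP/rootP.
  by rewrite rE root_prod_XsubC.
have p0 : v (iota p`_0) = v x ^+ size r.
  rewrite -coef_map rE -horner_coef0 horner_prod absval_prod.
  rewrite (eq_big_seq (fun=> v x)) => [|z zr].
    by rewrite big_const_seq count_predT iter_mulr_1.
  by rewrite hornerXsubC sub0r absval_opp vr.
have r0 : (0 < size r)%N.
  have [sp _] := irr; move: sp.
  by rewrite -(size_map_poly iota) rE size_prod_XsubC ltnS.
have [n] : exists n : int, v (iota p`_0) = rad n%:~R.
  apply: base_value; rewrite -(fmorph_eq0 iota) -(absval_eq0 v) p0.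
  by rewrite expf_eq0 absval_eq0 (negPf x0) andbF.
rewrite p0 => E; exists (n%:~R / (size r)%:R).
apply/eqP; rewrite -(@eqrXn2 _ (size r)) ?av_ge0 ?(ltW (rad_gt0 _)) //.
by rewrite E radX divfK // pnatr_eq0 -lt0n.
Qed.

(** With [d] the denominator of [a], a bound on [v x] by a rational radius becomes a bound on
    [v (x ^+ d)] by a value of [K], which rational domains can express. *)
Lemma rad_power a : exists2 d : nat, (0 < d)%N &
  exists2 c : K, c != 0 & rad a ^+ d = v (iota c).
Proof.
have dn : (denq a = `|denq a|%N)%R by rewrite gez0_abs // denq_ge0.
exists `|denq a|%N; first by rewrite absz_gt0 denq_neq0.
have [c c0 cE] := base_rad (numq a); exists c => //.
rewrite radX cE; congr rad.
rewrite -[X in X * _]divq_num_den -[_%:R]/((`|denq a|%N : int)%:~R) -dn divfK //.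
by rewrite intr_eq0 denq_neq0.
Qed.

Lemma exists_rad a : exists2 x : L, x != 0 & v x = rad a.
Proof.
have [d d0 [c c0 cE]] := rad_power a.
have [x /rootP] : exists x, root ('X^d - (iota c)%:P) x.
  by apply/closed_rootP; rewrite size_XnsubC // eqSS -lt0n.
rewrite hornerD hornerN hornerXn hornerC => /eqP; rewrite subr_eq0 => /eqP xc.
have vx : v x = rad a.
  apply/eqP; rewrite -(@eqrXn2 _ d) ?av_ge0 ?(ltW (rad_gt0 _)) //.
  by rewrite -absvalX xc cE.
by exists x => //; rewrite -(absval_gt0 v) vx rad_gt0.
Qed.

Lemma coprimep_polyC (c : K) p : c != 0 -> coprimep p c%:P.
Proof. by move=> c0; rewrite -[c%:P]mulr1 mul_polyC coprimepZr // coprimep1. Qed.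

(** The additional inequalities [s] serve to cut out loci where a given polynomial stays away from
    [0]. *)
Lemma rational_annulus a b (s : seq ({poly K} * {poly K})) :
  (forall gh, gh \in s -> coprimep gh.1 gh.2) ->
  exists2 Z, rational_domain iota v Z & forall x, Z (pt x) <->
    (rad b <= v x <= rad a) /\
    forall gh, gh \in s -> v (pval gh.1 x) <= v (pval gh.2 x).
Proof.
move=> cop; have [c c0 cE] := base_rad (Num.floor a).
have [d d0 [ca ca0 caE]] := rad_power a; have [e e0 [cb cb0 cbE]] := rad_power b.
pose s' := ('X^d, ca%:P) :: (cb%:P, 'X^e) :: s.
exists (cut_out iota (rational_cond iota v c s')).
  exists c, s'; split=> // gh; rewrite !inE => /or3P[/eqP->|/eqP->|/cop//] /=.
    exact: coprimep_polyC.
  by rewrite coprimep_sym coprimep_polyC.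
move=> x; rewrite (cut_outE (hL := hL)); last first.
  by move=> y z; apply: rational_cond_pt.
have vX n t q : (0 < n)%N -> rad q ^+ n = v (iota t) ->
  ((v x <= rad q) = (v (pval 'X^n x) <= v (pval t%:P x))) *
  ((rad q <= v x) = (v (pval t%:P x) <= v (pval 'X^n x))).
  move=> n0 nt; rewrite pvalXn pvalC absvalX -nt.
  by rewrite !(ler_pXn2r n0) ?nnegrE ?av_ge0 ?(ltW (rad_gt0 _)).
split=> [[xc xs]|[/andP[xb xa] xs]].
  split=> [|gh hs]; last by apply: xs; rewrite !inE hs !orbT.
  rewrite (vX _ _ _ e0 cbE) (vX _ _ _ d0 caE).
  by rewrite (xs ('X^d, _)) ?(xs (cb%:P, _)) // !inE eqxx ?orbT.
split=> [|gh]; first by rewrite (le_trans xa) // cE rad_le floor_le.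
rewrite !inE => /or3P[/eqP->|/eqP->|/xs//] /=.
  by rewrite -(vX _ _ _ d0 caE).
by rewrite -(vX _ _ _ e0 cbE).
Qed.

End Radii.

(** * Absolute values of units on an annulus *)

Definition in_exponents (P : annulus_type) (a b q : rat) : bool :=
  match P with
  | OpenAnnulus => a < q < b
  | SemiOpenAnnulus => a <= q < b
  | ClosedAnnulus => a <= q <= b
  end.

Lemma in_exponents_convex P a b q1 q2 q :
  in_exponents P a b q1 -> in_exponents P a b q2 -> q1 <= q <= q2 ->
  in_exponents P a b q.
Proof. by case: P => /=; lra. Qed.

Lemma in_exponents_two P a b : a < b -> exists q1 q2,
  [/\ in_exponents P a b q1, in_exponents P a b q2 & q1 < q2].
Proof.
move=> ab; exists ((2 * a + b) / 3), ((a + 2 * b) / 3).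
by case: P => /=; split; lra.
Qed.

Section UnitValues.
Variables (R : realType) (K : fieldType) (vK : absval R K) (pi : K).
Hypotheses (hpi : is_uniformizer vK pi) (hK : complete_absval vK).
Variables (L : closedFieldType) (iota : {rmorphism K -> L}) (v : absval R L).
Hypothesis hL : is_valued_closure iota vK v.
Local Notation pval := (pval iota).
Local Notation rad := (Defs.radius iota v pi).
Local Notation pt := (pt hL).

(* An irreducible polynomial has all its roots inside or all outside an annulus
   that contains none of them. *)
Lemma absval_irreducible_annulus a b y : ~~ (rad b <= v y <= rad a) ->
  exists c : K, exists m : nat, c != 0 /\ forall x, rad b <= v x <= rad a ->
    v (pval (sval (pt y)) x) = v (iota c) * v x ^+ m.
Proof.
have [mon irr] := svalP (pt y); have yr := pt_root hL y.
set p := sval (pt y) in mon irr yr *; have [r rE] := irreducible_split iota mon.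
have vr z : z \in r -> v z = v y.
  move=> zr; apply: (absval_pt hK (hL := hL)); apply/esym/pt_eqP/rootP.
  by rewrite -/p rE root_prod_XsubC.
have px x : v (pval p x) = \prod_(z <- r) v (x - z).
  rewrite /Defs.pval rE horner_prod absval_prod.
  by apply: eq_bigr => z _; rewrite hornerXsubC.
rewrite negb_and -!ltNge => /orP[yb|ay].
  exists 1, (size r); split; first exact: oner_neq0.
  move=> x /andP[bx xa]; rewrite px rmorph1 absval_is1 mul1r.
  rewrite (eq_big_seq (fun=> v x)) => [|z zr].
    by rewrite big_const_seq count_predT iter_mulr_1.
  by rewrite absval_subl // vr // (lt_le_trans yb).
(* All roots are now outside, every factor has value [v y], and the product of these is the value of
   the constant coefficient, an element of [K]. *)
have y0 : v y != 0 by rewrite gt_eqF // (lt_trans (rad_gt0 hpi hL a)).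
have p0 : v (iota p`_0) = v y ^+ size r.
  rewrite -coef_map -horner_coef0 -/(pval p 0) px.
  rewrite (eq_big_seq (fun=> v y)) => [|z zr].
    by rewrite big_const_seq count_predT iter_mulr_1.
  by rewrite sub0r absval_opp vr.
exists p`_0, 0%N; split.
  by rewrite -(fmorph_eq0 iota) -(absval_eq0 v) p0 expf_neq0.
move=> x /andP[bx xa]; rewrite expr0 mulr1 p0 px.
rewrite (eq_big_seq (fun=> v y)) => [|z zr].
  by rewrite big_const_seq count_predT iter_mulr_1.
have xz : v x < v z by rewrite (vr z zr) (le_lt_trans xa).
by rewrite absval_subr // vr.
Qed.

(** Induction on the size: the minimal polynomial of a root of [g] divides [g], and that root is
    outside the annulus by [nz]. The condition [a <= b] makes the annulus nonempty, so that [nz]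
    excludes [g = 0]. *)
Lemma absval_poly_annulus a b (g : {poly K}) : a <= b ->
  (forall x, rad b <= v x <= rad a -> pval g x != 0) ->
  exists c : K, exists m : nat, c != 0 /\ forall x, rad b <= v x <= rad a ->
    v (pval g x) = v (iota c) * v x ^+ m.
Proof.
move=> ab; have [n] := ubnP (size g); elim: n g => // n IH g /ltnSE sg nz.
have [x0 _ x0a] := exists_rad hpi hL a.
have g0 : g != 0.
  apply/eqP => g0; have := nz x0.
  by rewrite x0a !(rad_le hpi hL) ab lexx g0 pval0 eqxx => /(_ isT).
have [s1|s1] := eqVneq (size g) 1%N.
  have /size_poly1P[c c0 ->] : size g == 1%N by rewrite s1.
  exists c, 0%N; split=> // x _; by rewrite pvalC expr0 mulr1.
have [y /rootP gy] : exists y, root (map_poly iota g) y.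
  by apply/closed_rootP; rewrite size_map_poly.
have [_ irr] := svalP (pt y).
have /dvdpP[h gE] := irreducible_dvdp irr (pt_root hL y) gy.
have nya : ~~ (rad b <= v y <= rad a).
  by apply/negP => /nz; rewrite [pval _ _]gy eqxx.
have [c1 [m1 [c10 E1]]] := absval_irreducible_annulus nya.
have h0 : h != 0 by apply: contraNneq g0 => h0; rewrite gE h0 mul0r.
have sh : (size h < n)%N.
  have [sq _] := irr; apply: leq_trans sg; rewrite gE size_mul ?(irredp_neq0 irr) //.
  by rewrite -(prednK (ltnW sq)) addnS -addn1 leq_add2l -ltnS prednK // ltnW.
have [x xa|c2 [m2 [c20 E2]]] := IH h sh.
  by apply: contraNneq (nz x xa) => hx; rewrite gE pvalM hx mul0r.
exists (c1 * c2), (m1 + m2)%N; split; first by rewrite mulf_neq0.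
move=> x xa; rewrite gE pvalM av_mul E1 // E2 // rmorphM av_mul exprD.
by ring.
Qed.

(** The bound on the inverse [f'] bounds [f] from below, so a rational function close enough to [f]
    has the same absolute value on all of [Z]; its numerator and denominator are then free of zeros
    there. *)
Lemma absval_unit_closed U (f f' : geom iota U -> L) a b Z : a <= b ->
  analytic v f -> analytic v f' -> (forall y, f y * f' y = 1) ->
  rational_domain iota v Z -> Z `<=` U ->
  (forall x, Z (pt x) <-> rad b <= v x <= rad a) ->
  exists n m : int, forall y q, a <= q <= b -> v (sval y) = rad q ->
    v (f y) = rad (n%:~R + m%:~R * q).
Proof.
move=> ab fa fa' ff' Zr ZU ZE.
have [_ fapp] := fa Z Zr ZU; have [[M fM] _] := fa' Z Zr ZU.
(* The maximum ensures positivity, and the precision [(M' + 1)^-1] is strictly below the lower bound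
   [M'^-1] for [f]. *)
pose M' := Num.max 1 M; have M'1 : 1 <= M' by rewrite le_max lexx.
have M'0 : 0 < M' by apply: lt_le_trans M'1.
have [|g [h gh]] := fapp (M' + 1)^-1; first by rewrite invr_gt0 ltr_wpDr.
have low y : lies_over iota Z (sval y) -> (M' + 1)^-1 < v (f y).
  move=> /fM yM; have E : v (f y) * v (f' y) = 1.
    by rewrite -av_mul ff' absval_is1.
  have f0 : v (f' y) != 0.
    by apply: contra_eqN E => /eqP ->; rewrite mulr0 eq_sym oner_eq0.
  have -> : v (f y) = (v (f' y))^-1.
    by apply: (mulIf f0); rewrite E mulVf.
  have p0 : 0 < v (f' y) by rewrite lt_def f0 av_ge0.
  have M1 : 0 < M' + 1 by rewrite ltr_wpDr.
  rewrite ltf_pV2 ?posrE // (@le_lt_trans _ _ M') ?ltrDl //.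
  by rewrite le_max yM orbT.
have over x : rad b <= v x <= rad a -> lies_over iota Z x.
  by move=> xa; apply/(lies_overE hL)/ZE.
have pick x : rad b <= v x <= rad a -> exists y : geom iota U, sval y = x.
  move=> xa; suff xU : lies_over iota U x by exists (exist _ x xU).
  by apply/(lies_overE hL)/ZU/ZE.
have fE y : rad b <= v (sval y) <= rad a ->
    v (f y) = v (pval g (sval y) / pval h (sval y)).
  move=> /over yZ; have [_ app] := gh y yZ; have lt := low y yZ.
  set w := _ / _ in app *; rewrite -[w](subKr (f y)) absval_subl //.
  exact: le_lt_trans app lt.
have [x xa|cg [mg [cg0 gE]]] := @absval_poly_annulus a b g ab.
  have [y yx] := pick x xa; have := fE y; rewrite yx => /(_ xa).
  have := low y; rewrite yx => /(_ (over x xa)) lo vf.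
  apply: contraTneq lo => g0; rewrite vf g0 mul0r absval_is0 -leNgt.
  by rewrite invr_ge0 addr_ge0 // ltW.
have [x xa|ch [mh [ch0 hE]]] := @absval_poly_annulus a b h ab.
  have [y yx] := pick x xa; have := gh y; rewrite yx => /(_ (over x xa)).
  by case.
have [ng ngE] := base_value hpi hL cg0; have [nh nhE] := base_value hpi hL ch0.
exists (ng - nh), (mg%:Z - mh%:Z) => y q /andP[aq qb] yq.
have ya : rad b <= v (sval y) <= rad a by rewrite yq !(rad_le hpi hL) aq qb.
rewrite fE // av_mul absvalV gE // hE // ngE nhE yq !radX.
have rD := radD hpi hL; have r0 t := lt0r_neq0 (rad_gt0 hpi hL t).
rewrite -!rD; apply: (mulIf (r0 (nh%:~R + q * mh%:R))).
rewrite divfK // -rD; congr rad.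
by rewrite !rmorphB /=; ring.
Qed.

Lemma in_annulusE P a b q :
  in_annulus iota v pi P a b (rad q) <-> in_exponents P a b q.
Proof.
by case: P; rewrite /in_annulus /= ?(rad_lt hpi hL) ?(rad_le hpi hL) andbC.
Qed.

Definition annulus P a b : set (closed_point K) :=
  cut_out iota (fun x => in_annulus iota v pi P a b (v x)).

Lemma annulusE P a b x :
  annulus P a b (pt x) <-> in_annulus iota v pi P a b (v x).
Proof.
by apply: cut_outE => y z yz; rewrite (absval_pt hK yz).
Qed.

Lemma in_annulus_exp P a b x : in_annulus iota v pi P a b (v x) ->
  exists2 q, v x = rad q & in_exponents P a b q.
Proof.
move=> xS; have [q xq] : exists q, v x = rad q.
  apply: (absval_rad hpi hK hL); rewrite -(absval_gt0 v).
  have := rad_gt0 hpi hL b.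
  by case: P xS => /andP[bx _] b0; [apply: lt_trans bx|apply: lt_trans bx|
    apply: lt_le_trans bx].
by exists q => //; apply/in_annulusE; rewrite -xq.
Qed.

(** Analyticity on an annulus of any type speaks only about rational domains inside it; these closed
    subannuli are the ones used to reach a given exponent. *)
Lemma subannulus P a b q1 q2 :
  in_exponents P a b q1 -> in_exponents P a b q2 ->
  exists Z, [/\ rational_domain iota v Z, Z `<=` annulus P a b &
    forall x, Z (pt x) <-> rad q2 <= v x <= rad q1].
Proof.
move=> h1 h2; have [|Z Zr ZE] := @rational_annulus _ _ _ _ hpi hK _ _ _ hL q1 q2 [::].
  by [].
have ZE' x : Z (pt x) <-> rad q2 <= v x <= rad q1 by rewrite ZE; split=> [[]|].
exists Z; split=> // p; have [x <-] := pt_surj hL p.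
move=> /ZE' xq; apply/annulusE.
have [q xE] : exists q, v x = rad q.
  apply: (absval_rad hpi hK hL); rewrite -(absval_gt0 v).
  by case/andP: xq => h _; apply: lt_le_trans h; apply: (rad_gt0 hpi hL).
move: xq; rewrite xE !(rad_le hpi hL) andbC => xq; apply/in_annulusE.
exact: in_exponents_convex h1 h2 xq.
Qed.

(** The integers [n], [m] are fixed on one closed subannulus with distinct end exponents [q1 < q2].
    For any other [q], the subannulus spanned by [q], [q1] and [q2] gives an affine function that
    agrees with the first one at both [q1] and [q2], hence everywhere. *)
Lemma absval_unit P a b (f f' : geom iota (annulus P a b) -> L) : a < b ->
  analytic v f -> analytic v f' -> (forall y, f y * f' y = 1) ->
  exists n m : int, forall y q, v (sval y) = rad q ->
    v (f y) = rad (n%:~R + m%:~R * q).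
Proof.
move=> ab fa fa' ff'.
have on q1 q2 : in_exponents P a b q1 -> in_exponents P a b q2 -> q1 <= q2 ->
    exists n m : int, forall y q, q1 <= q <= q2 -> v (sval y) = rad q ->
      v (f y) = rad (n%:~R + m%:~R * q).
  move=> h1 h2 h12; have [Z [Zr ZS ZE]] := subannulus h1 h2.
  exact: absval_unit_closed h12 fa fa' ff' Zr ZS ZE.
have [q1 [q2 [h1 h2 h12]]] := in_exponents_two P ab.
have [n [m nm]] := on _ _ h1 h2 (ltW h12).
have pick q : in_exponents P a b q ->
    exists y : geom iota (annulus P a b), v (sval y) = rad q.
  move=> hq; have [x _ xq] := exists_rad hpi hL q.
  suff xS : lies_over iota (annulus P a b) x by exists (exist _ x xS).
  by apply/(lies_overE hL)/annulusE; rewrite xq; apply/in_annulusE.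
have [y1 y1E] := pick _ h1; have [y2 y2E] := pick _ h2.
exists n, m => y q yq.
have hq : in_exponents P a b q.
  by apply/in_annulusE; rewrite -yq; apply/annulusE/(lies_overE hL)/svalP.
have hmin : in_exponents P a b (Num.min q q1) by rewrite minEle; case: ifP.
have hmax : in_exponents P a b (Num.max q q2) by rewrite maxEle; case: ifP.
have hle : Num.min q q1 <= Num.max q q2 by rewrite le_max ge_min lexx.
have [n' [m' nm']] := on _ _ hmin hmax hle.
have I1 : Num.min q q1 <= q1 <= Num.max q q2.
  by rewrite ge_min lexx le_max (ltW h12) !orbT.
have I2 : Num.min q q1 <= q2 <= Num.max q q2.
  by rewrite ge_min le_max lexx (ltW h12) !orbT.
have I0 : Num.min q q1 <= q <= Num.max q q2 by rewrite ge_min le_max lexx.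
rewrite (nm' y q I0 yq); congr rad.
have := nm' y1 q1 I1 y1E; rewrite (nm y1 q1) ?lexx ?(ltW h12) //.
move=> /(rad_inj hpi hL) E1.
have := nm' y2 q2 I2 y2E; rewrite (nm y2 q2) ?lexx ?(ltW h12) //.
move=> /(rad_inj hpi hL) E2.
have d0 : q2 - q1 != 0 by rewrite subr_eq0 gt_eqF.
have mm : m'%:~R = m%:~R :> rat.
  apply: (mulIf d0).
  have -> : m'%:~R * (q2 - q1) = (n'%:~R + m'%:~R * q2) - (n'%:~R + m'%:~R * q1)
    :> rat by ring.
  by rewrite -E1 -E2; ring.
by move: E1; rewrite mm => /addIr ->.
Qed.

End UnitValues.

(** * Isomorphisms of G-ringed spaces *)

Section SpaceIsomorphisms.
Variable K : fieldType.
Implicit Types X Y Z : gspace K.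

(** Opens with the same points can be different terms; restriction serves as the transport between
    their rings of sections. *)
Lemma gres_bij X (U V : gopens X) (h : sval V `<=` sval U)
    (h' : sval U `<=` sval V) : bijective (gres h).
Proof.
by exists (gres h') => s; rewrite (gres_comp _ _ (@subset_refl _ _)) gres_id.
Qed.

Lemma preimage_cancel (S T : Type) (f : S -> T) (g : T -> S) (A : set S) :
  cancel f g -> f @^-1` (g @^-1` A) = A.
Proof. by move=> fK; apply/seteqP; split=> x; rewrite /preimage /= fK. Qed.

Lemma image_preimage_cancel (S T : Type) (f : S -> T) (g : T -> S)
    (C : set (set S)) :
  cancel f g -> [set f @^-1` V | V in [set g @^-1` W | W in C]] = C.
Proof.
move=> fK; rewrite image_comp; apply/seteqP; split=> [_ [A CA <-]|A CA] /=.
  by rewrite preimage_cancel.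
by exists A => //=; rewrite preimage_cancel.
Qed.

Lemma giso_refl X : giso X X.
Proof.
have fo (U : set X) : gopen U -> gopen (idfun @^-1` U) by [].
have sub (U : gopens X) : sval (gpreim fo U) `<=` sval U by [].
have fc (U : set X) C :
    gcover U C -> gcover (idfun @^-1` U) [set idfun @^-1` V | V in C].
  by rewrite image_id.
have cE U a : gres (sub U) (gscal U a) = gscal (gpreim fo U) a.
  exact: gres_scal.
have rE (U V : gopens X) (h : sval V `<=` sval U) s :
    gres (sub V) (gres h s) = gres (gpreim_sub (fo := fo) h) (gres (sub U) s).
  by rewrite !(gres_comp _ _ (h : sval (gpreim fo V) `<=` _)).
exists (GMorphism fc cE rE); split=> /=; first by exists idfun.
- by [].
- by move=> U C; rewrite image_id.
by move=> U; apply: gres_bij.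
Qed.

Lemma giso_trans X Y Z : giso X Y -> giso Y Z -> giso X Z.
Proof.
move=> [f [fb fro frc fs]] [g [gb gro grc gs]].
have fo (U : set Z) : gopen U -> gopen ((g \o f) @^-1` U).
  by move=> /(gfun_open g) /(gfun_open f).
have imE (C : set (set Z)) : [set (g \o f) @^-1` V | V in C] =
    [set f @^-1` V | V in [set g @^-1` W | W in C]] by rewrite image_comp.
have fc (U : set Z) C :
    gcover U C -> gcover ((g \o f) @^-1` U) [set (g \o f) @^-1` V | V in C].
  by rewrite imE => /(gfun_cover g) /(gfun_cover f).
pose fgU (U : gopens Z) :=
  gpreim (@gfun_open _ _ _ f) (gpreim (@gfun_open _ _ _ g) U).
have sub (U : gopens Z) : sval (gpreim fo U) `<=` sval (fgU U) by [].
pose pull (U : gopens Z) : {rmorphism gsec U -> gsec (gpreim fo U)} :=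
  gres (sub U) \o (gpull f (gpreim (@gfun_open _ _ _ g) U) \o gpull g U).
have cE U a : pull U (gscal U a) = gscal (gpreim fo U) a.
  by rewrite /pull /= !gpull_scal gres_scal.
have rE (U V : gopens Z) (h : sval V `<=` sval U) s :
    pull V (gres h s) = gres (gpreim_sub (fo := fo) h) (pull U s).
  rewrite /pull /= !gpull_res.
  have h2 : sval (gpreim fo V) `<=` sval (fgU U) by move=> x; apply: h.
  by rewrite !(gres_comp _ _ h2).
exists (GMorphism fc cE rE); split=> /=; first exact: bij_comp.
- by move=> U /(fro (g @^-1` U)) /gro.
- by move=> U C; rewrite imE => /(frc (g @^-1` U)) /grc.
- move=> U; apply: bij_comp; first exact: gres_bij.
  by apply: bij_comp; [apply: fs|apply: gs].
Qed.

Lemma rmorphism_inverse (A B : comPzRingType) (f : {rmorphism A -> B}) :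
  bijective f -> exists g : {rmorphism B -> A}, cancel f g /\ cancel g f.
Proof.
move=> [g fK gK]; have finj := can_inj fK.
have gB : zmod_morphism g.
  by move=> x y; apply: finj; rewrite rmorphB !gK.
have gM : monoid_morphism g.
  by split=> [|x y]; apply: finj; rewrite ?rmorph1 ?rmorphM !gK.
pose mB := GRing.isZmodMorphism.Build B A g gB.
pose mM := GRing.isMonoidMorphism.Build B A g gM.
pose gm : {rmorphism B -> A} := HB.pack g mB mM.
by exists gm.
Qed.

Lemma giso_sym X Y : giso X Y -> giso Y X.
Proof.
move=> [f [[g fK gK] fro frc fs]].
have go (U : set X) : gopen U -> gopen (g @^-1` U).
  by move=> oU; apply: fro; rewrite preimage_cancel.
have gc (U : set X) C : gcover U C -> gcover (g @^-1` U) [set g @^-1` V | V in C].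
  by move=> cU; apply: frc; rewrite preimage_cancel // image_preimage_cancel.
pose r (U : gopens Y) := projT1 (cid (rmorphism_inverse (fs U))).
have rP U : cancel (gpull f U) (r U) /\ cancel (r U) (gpull f U).
  exact: projT2 (cid (rmorphism_inverse (fs U))).
pose gf (U : gopens X) := gpreim (@gfun_open _ _ _ f) (gpreim go U).
have sub (U : gopens X) : sval (gf U) `<=` sval U.
  by rewrite /= preimage_cancel.
have sub' (U : gopens X) : sval U `<=` sval (gf U).
  by rewrite /= preimage_cancel.
(* Sections over [U] are moved to the double preimage [gf U], which has the same points, and there
   the pullback by [f] from [gpreim go U] is inverted. *)
pose pull (U : gopens X) : {rmorphism gsec U -> gsec (gpreim go U)} :=
  r (gpreim go U) \o gres (sub U).
have inj U := can_inj (rP U).1.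
have cE U a : pull U (gscal U a) = gscal (gpreim go U) a.
  by apply: inj; rewrite /pull /= (rP _).2 gres_scal gpull_scal.
have rE (U V : gopens X) (h : sval V `<=` sval U) s :
    pull V (gres h s) = gres (gpreim_sub (fo := go) h) (pull U s).
  apply: inj; rewrite /pull /= gpull_res !(rP _).2.
  have h2 : sval (gf V) `<=` sval U by move=> x /sub; apply: h.
  by rewrite !(gres_comp _ _ h2).
exists (GMorphism gc cE rE); split=> /=; first by exists f.
- by move=> U /(gfun_open f); rewrite preimage_cancel.
- move=> U C /(gfun_cover f).
  by rewrite preimage_cancel // image_preimage_cancel.
- move=> U; apply: bij_comp; last exact: gres_bij.
  by exists (gpull f (gpreim go U)); case: (rP (gpreim go U)).
Qed.

End SpaceIsomorphisms.

(** * The map c / x *)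

Section Inversion.
Variables (R : realType) (K : fieldType) (vK : absval R K) (pi : K).
Hypotheses (hpi : is_uniformizer vK pi) (hK : complete_absval vK).
Variables (L : closedFieldType) (iota : {rmorphism K -> L}) (v : absval R L).
Hypothesis hL : is_valued_closure iota vK v.
Local Notation pval := (pval iota).
Local Notation rad := (Defs.radius iota v pi).
Local Notation pt := (pt hL).
Variables (c : K) (n : int).
Hypotheses (c0 : c != 0) (cn : v (iota c) = rad n%:~R).

(* Since [x / 0 = 0], this is an involution of the whole of [L]. *)
Definition inversion (x : L) : L := iota c / x.

Lemma iotac0 : iota c != 0.
Proof. by rewrite fmorph_eq0. Qed.

Lemma inversionK : involutive inversion.
Proof. by move=> x; rewrite /inversion invf_div mulrCA divff ?mulr1 ?iotac0. Qed.

(** This is [X^d g(c / X)], the reciprocal polynomial twisted by [c]; [d] may exceed the degree of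
    [g]. *)
Definition reverse_poly d (g : {poly K}) : {poly K} :=
  \poly_(i < d.+1) (g`_(d - i) * c ^+ (d - i)).

Lemma pval_reverse d (g : {poly K}) x : x != 0 -> (size g <= d.+1)%N ->
  pval (reverse_poly d g) x = x ^+ d * pval g (inversion x).
Proof.
move=> x0 sg; rewrite (pval_coefE _ _ (size_poly _ _)) (pval_coefE _ _ sg).
rewrite mulr_sumr (reindex_inj rev_ord_inj) /=; apply: eq_bigr => i _.
have id : (i <= d)%N by rewrite -ltnS.
rewrite coef_poly subSS ltnS leq_subr subKn // rmorphM rmorphXn /=.
rewrite -mulrA [RHS]mulrCA; congr (_ * _).
have -> : x ^+ d = x ^+ (d - i) * x ^+ i by rewrite -exprD subnK.
rewrite /inversion exprMn exprVn.
by field; rewrite expf_neq0.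
Qed.

Lemma pval_reverse0 d (g : {poly K}) :
  pval (reverse_poly d g) 0 = iota (g`_d * c ^+ d).
Proof.
by rewrite /Defs.pval horner_coef0 coef_map coef_poly subn0.
Qed.

(** The reversal of the minimal polynomial of [c / x] vanishes at [x], hence at its conjugate [y].
    Zero is only conjugate to itself and is treated apart, since reversal does not express the value
    at [c / 0]. *)
Lemma pt_inversion x y : pt x = pt y -> pt (inversion x) = pt (inversion y).
Proof.
move=> xy; have [x0|x0] := eqVneq x 0.
  have /eqP : pval 'X y = 0 by apply: pval_eq0_pt xy _; rewrite pvalX.
  by rewrite pvalX x0 => /eqP ->.
have y0 : y != 0.
  apply: contra_neq x0 => y0; have := @pval_eq0_pt _ _ _ _ _ _ hL 'X _ _ (esym xy).
  by rewrite !pvalX; apply.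
apply/pt_eqP; set q := sval _.
have := @pval_eq0_pt _ _ _ _ _ _ hL (reverse_poly (size q) q) _ _ xy.
rewrite !pval_reverse // pt_root mulr0 => /(_ erefl)/eqP.
by rewrite mulf_eq0 expf_eq0 (negPf y0) andbF => /eqP.
Qed.

Definition point_inversion (p : closed_point K) : closed_point K :=
  pt (inversion (projT1 (cid (pt_surj hL p)))).

Lemma point_inversionE x : point_inversion (pt x) = pt (inversion x).
Proof. by apply: pt_inversion; apply: projT2 (cid (pt_surj hL (pt x))). Qed.

Lemma point_inversionK : involutive point_inversion.
Proof.
by move=> p; have [x <-] := pt_surj hL p; rewrite !point_inversionE inversionK.
Qed.

(** Such a set stays away from [0] and is bounded, so that its inverse is again bounded and avoids
    [0]. *)
Definition radii_in a b (A : set (closed_point K)) : Prop :=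
  forall x, A (pt x) -> rad b <= v x <= rad a.

Lemma radii_in_sub a b A B : A `<=` B -> radii_in a b B -> radii_in a b A.
Proof. by move=> AB hB x /AB/hB. Qed.

Lemma absval_inversion x q :
  v x = rad q -> v (inversion x) = rad (n%:~R - q).
Proof.
move=> xq; rewrite /inversion av_mul absvalV xq cn.
have r0 := lt0r_neq0 (rad_gt0 hpi hL q).
by apply: (mulIf r0); rewrite divfK // -(radD hpi hL) subrK.
Qed.

Lemma radii_in_inversion a b A : radii_in a b A ->
  radii_in (n%:~R - b) (n%:~R - a) (point_inversion @^-1` A).
Proof.
move=> hA x; rewrite /preimage /= point_inversionE => /hA xa.
have x0 : inversion x != 0.
  rewrite -(absval_gt0 v); case/andP: xa => + _; apply: lt_le_trans.
  exact: (rad_gt0 hpi hL).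
have [q qE] := absval_rad hpi hK hL x0.
rewrite -[x]inversionK (absval_inversion qE); move: xa.
rewrite qE !(rad_le hpi hL) => /andP[? ?]; rewrite !lerD2l !lerN2 andbC.
exact/andP.
Qed.

(** A common root [x != 0] of the reversals gives the common root [c / x] of [g] and [h]. At [0] the
    reversals take the values of the coefficients of degree [d] times [c ^+ d], whence the condition
    that these are not both zero. *)
Lemma coprimep_reverse d (g h : {poly K}) :
  (size g <= d.+1)%N -> (size h <= d.+1)%N ->
  (g`_d != 0) || (h`_d != 0) -> coprimep g h ->
  coprimep (reverse_poly d g) (reverse_poly d h).
Proof.
move=> sg sh gh cop; rewrite -(coprimep_map iota).
apply: Pdiv.ClosedField.root_coprimep => x /rootP.
rewrite -/(pval _ x) -[_.[x]]/(pval _ x).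
have [->|x0] := eqVneq x 0.
  rewrite !pval_reverse0 => /eqP; rewrite !fmorph_eq0 !mulf_eq0.
  rewrite !expf_eq0 (negPf c0) andbF !orbF => gd.
  by rewrite gd in gh.
rewrite !pval_reverse // => /eqP; rewrite !mulf_eq0 !negb_or.
rewrite expf_eq0 (negPf x0) andbF /= => gx; move: cop.
by rewrite -(coprimep_map iota) => /coprimep_root; apply.
Qed.

(** Each inequality at [c / x] is multiplied by [x ^+ d], and the old disc condition becomes
    [|c| <= |c1 x|]. The new ambient disc is supplied by the bounds on the radii. *)
Lemma rational_domain_inversion a b Z : rational_domain iota v Z ->
  radii_in a b Z -> rational_domain iota v (point_inversion @^-1` Z).
Proof.
move=> /(rational_domainE hK hL)[c1 [s [c10 cop ZE]]] Zab.
have Zab' := radii_in_inversion Zab.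
have [c2 c20 c2E] := base_rad hpi hL (Num.floor (n%:~R - b)).
(* The larger of the two degrees: one leading coefficient then sits in degree [deg gh], as
   [coprimep_reverse] requires. *)
pose deg (gh : {poly K} * {poly K}) := (maxn (size gh.1) (size gh.2)).-1.
pose rev (gh : {poly K} * {poly K}) :=
  (reverse_poly (deg gh) gh.1, reverse_poly (deg gh) gh.2).
have sdeg (gh : {poly K} * {poly K}) :
    (size gh.1 <= (deg gh).+1)%N /\ (size gh.2 <= (deg gh).+1)%N.
  by rewrite /deg; split; rewrite (leq_trans _ (leqSpred _)) // leq_max leqnn ?orbT.
apply/(rational_domainE hK hL).
exists c2, ((c%:P, c1 *: 'X) :: map rev s); split=> //.
  move=> gh; rewrite inE => /orP[/eqP->|/mapP[[g h] ghs ->]] /=.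
    by rewrite coprimep_sym coprimep_polyC.
  have [/= sg sh] := sdeg (g, h); apply: coprimep_reverse (cop _ ghs) => //.
  apply: contraTT (cop _ ghs); rewrite negb_or !negbK /deg /=.
  have [le|le] := leqP (size g) (size h).
    rewrite -lead_coefE lead_coef_eq0 => /andP[_ /eqP h0].
    move: le; rewrite h0 size_poly0 leqn0 size_poly_eq0 => /eqP->.
    by rewrite coprimep0 -size_poly_eq1 size_poly0.
  rewrite -lead_coefE lead_coef_eq0 => /andP[/eqP g0].
  by move: le; rewrite g0 size_poly0.
have shift x (gh : {poly K} * {poly K}) : x != 0 ->
    (v (pval (rev gh).1 x) <= v (pval (rev gh).2 x)) =
    (v (pval gh.1 (inversion x)) <= v (pval gh.2 (inversion x))).
  move=> x0; have [sg sh] := sdeg gh; rewrite /rev /= !pval_reverse //.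
  by rewrite !av_mul ler_pM2l // absval_gt0 expf_neq0.
have disc x : x != 0 -> (v (pval c%:P x) <= v (pval (c1 *: 'X) x)) =
    (v (inversion x) <= v (iota c1)).
  move=> x0; rewrite pvalC pvalZ pvalX /inversion !av_mul absvalV.
  by rewrite ler_pdivrMr ?absval_gt0.
move=> x; split=> [Zx|[xc xs]].
  have x0 : x != 0.
    have /andP[+ _] := Zab' _ Zx; rewrite -(absval_gt0 v); apply: lt_le_trans.
    exact: (rad_gt0 hpi hL).
  split.
    have /andP[_ xb] := Zab' _ Zx; rewrite c2E (le_trans xb) //.
    by rewrite (rad_le hpi hL) floor_le.
  move: Zx; rewrite /preimage /= point_inversionE => /ZE[xc xs] gh.
  rewrite inE => /orP[/eqP->|/mapP[gh' ghs ->]] /=; first by rewrite disc.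
  by rewrite (shift _ gh') // xs.
(* The inequality [|c| <= |c1 x|] excludes [0] because [c] is nonzero. *)
have x0 : x != 0.
  have := xs (c%:P, c1 *: 'X); rewrite inE eqxx => /(_ isT) /=.
  apply: contraTneq => ->; rewrite pvalC pvalZ pvalX mulr0 absval_is0 -ltNge.
  by rewrite absval_gt0 iotac0.
rewrite /preimage /= point_inversionE; apply/ZE; split.
  by rewrite -disc //; apply: (xs (_, _)); rewrite inE eqxx.
by move=> gh ghs; rewrite -shift //; apply: xs; rewrite inE map_f ?orbT.
Qed.

Lemma preimage_inversionK A : point_inversion @^-1` (point_inversion @^-1` A) = A.
Proof. exact: preimage_cancel point_inversionK. Qed.

Lemma admissible_open_inversion a b U : radii_in a b U ->
  admissible_open iota v U -> admissible_open iota v (point_inversion @^-1` U).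
Proof.
move=> Uab oU p /oU[Z [Zr ZU Zp]]; exists (point_inversion @^-1` Z); split=> //.
  exact: rational_domain_inversion Zr (radii_in_sub ZU Uab).
by move=> q /ZU.
Qed.

(** By involutivity a rational domain in the preimage is carried into [U], covered finitely there,
    and the finite cover is carried back. *)
Lemma admissible_cover_inversion a b U C : radii_in a b U ->
  admissible_cover iota v U C ->
  admissible_cover iota v (point_inversion @^-1` U)
    [set point_inversion @^-1` V | V in C].
Proof.
move=> Uab [Co UE fin].
have CU V : C V -> V `<=` U by move=> CV p Vp; rewrite UE; exists V.
split.
- move=> _ [V CV <-]; apply: admissible_open_inversion (Co _ CV).
  exact: radii_in_sub (CU _ CV) Uab.
- by rewrite bigcup_image UE preimage_bigcup.
move=> Z Zr ZU; have Z'U : point_inversion @^-1` Z `<=` U.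
  by move=> p /ZU; rewrite /preimage /= point_inversionK.
have Z'r : rational_domain iota v (point_inversion @^-1` Z).
  exact: rational_domain_inversion Zr (radii_in_sub ZU (radii_in_inversion Uab)).
have [s [sC sZ]] := fin _ Z'r Z'U.
exists [seq point_inversion @^-1` W | W <- s]; split.
  move=> _ /mapP[W Ws ->]; have [Wr [V CV WV]] := sC W Ws; split.
    apply: rational_domain_inversion Wr _.
    exact: radii_in_sub WV (radii_in_sub (CU _ CV) Uab).
  by exists (point_inversion @^-1` V); [exists V|move=> p /WV].
move=> p Zp; have [|W Ws Wp] := sZ (point_inversion p).
  by rewrite /preimage /= point_inversionK.
by exists (point_inversion @^-1` W) => //; apply: map_f.
Qed.

Section Pullback.
Variables (a b : rat) (U U' : set (closed_point K)).
Hypotheses (Uab : radii_in a b U) (UU' : U' `<=` point_inversion @^-1` U).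

Lemma lies_over_inversion x :
  lies_over iota U' x -> lies_over iota U (inversion x).
Proof.
by move=> /(lies_overE hL)/UU' Ux; apply/(lies_overE hL); rewrite -point_inversionE.
Qed.

Definition geom_inversion (y : geom iota U') : geom iota U :=
  exist _ (inversion (sval y)) (lies_over_inversion (svalP y)).

Lemma analytic_inversion (f : afun iota v U) :
  (f \o geom_inversion) \in analytic_pred v U'.
Proof.
apply/asboolP => Z Zr ZU'.
have U'ab := radii_in_sub UU' (radii_in_inversion Uab).
have Z'U : point_inversion @^-1` Z `<=` U.
  by move=> p /ZU'/UU'; rewrite /preimage /= point_inversionK.
have Z'r : rational_domain iota v (point_inversion @^-1` Z).
  exact: rational_domain_inversion Zr (radii_in_sub ZU' U'ab).
have /asboolP/(_ _ Z'r Z'U)[[M fM] fe] := afun_analytic f.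
have over (y : geom iota U') : lies_over iota Z (sval y) ->
    lies_over iota (point_inversion @^-1` Z) (inversion (sval y)).
  move=> /(lies_overE hL) Zy; apply/(lies_overE hL).
  by rewrite /preimage /= point_inversionE inversionK.
split; first by exists M => y /over yZ; apply: fM.
(* A common [d] for numerator and denominator makes the two factors [x ^+ d] cancel. *)
move=> e /fe[g [h gh]]; pose d := maxn (size g) (size h).
exists (reverse_poly d g), (reverse_poly d h) => y yZ.
have [h0 app] := gh (geom_inversion y) (over _ yZ).
have y0 : sval y != 0.
  have /andP[+ _] := U'ab _ (ZU' _ ((lies_overE hL _ _).1 yZ)).
  by rewrite -(absval_gt0 v); apply: lt_le_trans; apply: (rad_gt0 hpi hL).
rewrite !pval_reverse // ?leqW ?leq_maxl ?leq_maxr //.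
split; first by rewrite mulf_neq0 ?expf_neq0.
by rewrite -mulf_div divff ?mul1r ?expf_neq0.
Qed.

Definition afun_inversion (f : afun iota v U) : afun iota v U' :=
  AFun (analytic_inversion f).

Lemma afun_inversion_is_zmod : zmod_morphism afun_inversion.
Proof. by move=> f g; apply/val_inj. Qed.

Lemma afun_inversion_is_monoid : monoid_morphism afun_inversion.
Proof. by split=> [|f g]; apply/val_inj. Qed.

HB.instance Definition _ :=
  GRing.isZmodMorphism.Build (afun iota v U) (afun iota v U') afun_inversion
    afun_inversion_is_zmod.
HB.instance Definition _ :=
  GRing.isMonoidMorphism.Build (afun iota v U) (afun iota v U') afun_inversion
    afun_inversion_is_monoid.

End Pullback.

Lemma afun_inversionK a b a' b' U U' (Uab : radii_in a b U)
    (U'ab : radii_in a' b' U') (UU' : U' `<=` point_inversion @^-1` U)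
    (U'U : U `<=` point_inversion @^-1` U') :
  cancel (afun_inversion Uab UU') (afun_inversion U'ab U'U).
Proof.
move=> f; apply/val_inj/funext => -[x xU] /=; congr (afun_val f _).
by apply: eq_exist; rewrite /= inversionK.
Qed.

Section SubspaceInversion.
Variables (a b : rat) (S : set (closed_point K)).
Hypothesis Sab : radii_in a b S.
Let S' := point_inversion @^-1` S.

Definition sub_inversion (p : sub_point S') : sub_point S :=
  exist _ (point_inversion (sval p)) (svalP p).

Lemma sub_image_inversion (U : set (sub_point S)) :
  sub_image (sub_inversion @^-1` U) = point_inversion @^-1` sub_image U.
Proof.
apply/seteqP; split=> [_ [p Up <-]|p [[q Sq] Uq /= qp]].
  by exists (sub_inversion p).
have Sp : S' p by rewrite /S' /preimage /= -qp.
exists (exist _ p Sp) => //; rewrite /preimage /=.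
suff -> : sub_inversion (exist _ p Sp) = exist _ q Sq by [].
exact: eq_exist.
Qed.

Lemma sub_image_sub (T : set (closed_point K)) (U : set (sub_point T)) :
  sub_image U `<=` T.
Proof. by move=> _ [p _ <-]; apply: svalP. Qed.

Lemma sub_image_image_inversion (C : set (set (sub_point S))) :
  [set sub_image W | W in [set sub_inversion @^-1` V | V in C]] =
  [set point_inversion @^-1` A | A in [set sub_image V | V in C]].
Proof.
by rewrite !image_comp; apply: eq_imagel => V _; apply: sub_image_inversion.
Qed.

Let Uab U : radii_in a b (@sub_image _ S U) :=
  radii_in_sub (@sub_image_sub _ U) Sab.

Lemma sub_open_inversion U :
  sub_open iota v U -> sub_open iota v (sub_inversion @^-1` U).
Proof.
rewrite /sub_open sub_image_inversion.
exact: admissible_open_inversion (@Uab U).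
Qed.

Lemma sub_cover_inversion U C : sub_cover iota v U C ->
  sub_cover iota v (sub_inversion @^-1` U) [set sub_inversion @^-1` V | V in C].
Proof.
rewrite /sub_cover sub_image_image_inversion sub_image_inversion.
exact: admissible_cover_inversion (@Uab U).
Qed.

Let X := Defs.subspace iota v S'.
Let Y := Defs.subspace iota v S.
Let fo : forall U : set Y, gopen U -> gopen ((sub_inversion : X -> Y) @^-1` U) :=
  sub_open_inversion.

Lemma gpreim_inversion (U : gopens Y) :
  sub_image (sval (gpreim fo U)) `<=` point_inversion @^-1` sub_image (sval U).
Proof. by rewrite -sub_image_inversion. Qed.

Definition pull_inversion (U : gopens Y) :
    {rmorphism gsec U -> gsec (gpreim fo U)} :=
  afun_inversion (@Uab (sval U)) (@gpreim_inversion U).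

(** Because [point_inversion] is an involution, each converse condition is the direct one applied to
    the preimage. The set [S] is arbitrary, since the inverse of a semi-open annulus is not an
    annulus of the same type. *)
Lemma giso_inversion : giso X Y.
Proof.
have cE U k : pull_inversion U (gscal U k) = gscal (gpreim fo U) k.
  exact/val_inj.
have rE (U V : gopens Y) (h : sval V `<=` sval U) s :
    pull_inversion V (gres h s) =
      gres (gpreim_sub (fo := fo) h) (pull_inversion U s).
  apply/val_inj/funext => y /=; congr (afun_val s _); exact: eq_exist.
exists (@GMorphism _ X Y sub_inversion fo sub_cover_inversion _ cE rE).
have S'ab := radii_in_inversion Sab.
have Wab (W : set (sub_point S')) := radii_in_sub (@sub_image_sub _ W) S'ab.
split=> /=.
- have bK (p : sub_point S) : S' (point_inversion (sval p)).
    by rewrite /S' /preimage /= point_inversionK; apply: svalP.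
  by exists (fun p => exist _ _ (bK p)) => -[p Sp]; apply: eq_exist => /=;
    rewrite point_inversionK.
- move=> U /= oU; rewrite /sub_open -[sub_image U]preimage_inversionK.
  rewrite -sub_image_inversion; exact: admissible_open_inversion (Wab _) oU.
- move=> U C /= cU; rewrite /sub_cover -[sub_image U]preimage_inversionK.
  rewrite -sub_image_inversion.
  have -> : [set sub_image V | V in C] = [set point_inversion @^-1` A | A in
      [set sub_image W | W in [set sub_inversion @^-1` V | V in C]]].
    rewrite sub_image_image_inversion image_preimage_cancel //.
    exact: point_inversionK.
  exact: admissible_cover_inversion (Wab _) cU.
- move=> U.
  have UU : sub_image (sval U) `<=`
      point_inversion @^-1` sub_image (sval (gpreim fo U)).
    by rewrite /= sub_image_inversion preimage_inversionK.
  by exists (afun_inversion (Wab _) UU) => s; apply: afun_inversionK.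
Qed.

End SubspaceInversion.

End Inversion.

(** * Morphisms between annuli *)

Section AnalyticFunctions.
Variables (R : realType) (K : fieldType) (vK : absval R K).
Variables (L : closedFieldType) (iota : {rmorphism K -> L}) (v : absval R L).
Hypotheses (hK : complete_absval vK) (hL : is_valued_closure iota vK v).
Local Notation pval := (pval iota).

Lemma analytic_poly U (g : {poly K}) :
  analytic v (fun y : geom iota U => pval g (sval y)).
Proof.
move=> Z /(rational_domainE hK hL)[c [s [_ _ ZE]]] _; split; last first.
  move=> e e0; exists g, 1 => y _.
  by rewrite pval1 oner_eq0 divr1 subrr absval_is0 ltW.
exists (\sum_(i < size g) v (iota g`_i) * v (iota c) ^+ i) => y.
move=> /(lies_overE hL)/ZE[yc _]; rewrite (pval_coefE _ _ (leqnn _)).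
have nn i : 0 <= v (iota g`_i) * v (iota c) ^+ i.
  by rewrite mulr_ge0 ?exprn_ge0 ?av_ge0.
apply: absval_le_sum => [|i _]; first exact: sumr_ge0.
rewrite (bigD1 i) //= av_mul absvalX.
apply: (@le_trans _ _ (v (iota g`_i) * v (iota c) ^+ i)).
  by rewrite ler_wpM2l ?av_ge0 // lerXn2r ?nnegrE ?av_ge0.
by rewrite lerDl sumr_ge0.
Qed.

(** The uniform lower bound [e] is what bounds the inverse; the inverse is itself a rational
    function, so nothing has to be approximated. *)
Lemma analytic_poly_inv U (g : {poly K}) e : 0 < e ->
  (forall y : geom iota U, e <= v (pval g (sval y))) ->
  analytic v (fun y : geom iota U => (pval g (sval y))^-1).
Proof.
move=> e0 ge Z _ _; split.
  exists e^-1 => y _; rewrite absvalV lef_pV2 ?posrE //.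
  exact: lt_le_trans (ge y).
move=> d d0; exists 1, g => y _; rewrite pval1 div1r subrr absval_is0 ltW //.
by rewrite -(absval_gt0 v) (lt_le_trans e0).
Qed.

Definition poly_afun U (g : {poly K}) : afun iota v U :=
  AFun (introT (asboolP _) (@analytic_poly U g)).

Lemma poly_afunMD U g c :
  poly_afun U (g * 'X + c%:P) =
    poly_afun U g * poly_afun U 'X + afun_cst iota v U c.
Proof. by apply/val_inj/funext => y /=; rewrite pvalD pvalM pvalC. Qed.

Lemma poly_afun_unit U (g : {poly K}) e : 0 < e ->
  (forall y : geom iota U, e <= v (pval g (sval y))) ->
  exists h : afun iota v U, poly_afun U g * h = 1.
Proof.
move=> e0 ge; exists (AFun (introT (asboolP _) (analytic_poly_inv e0 ge))).
apply/val_inj/funext => y /=.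
rewrite -[LHS]/(pval g (sval y) / pval g (sval y)) divff //.
by rewrite -(absval_gt0 v) (lt_le_trans e0).
Qed.

End AnalyticFunctions.

(** * Action of a morphism on exponents *)

Section Rigidity.
Variables (R : realType) (K : fieldType) (vK : absval R K) (pi : K).
Hypotheses (hpi : is_uniformizer vK pi) (hK : complete_absval vK).
Variables (L : closedFieldType) (iota : {rmorphism K -> L}) (v : absval R L).
Hypothesis hL : is_valued_closure iota vK v.
Local Notation pval := (pval iota).
Local Notation rad := (Defs.radius iota v pi).
Local Notation pt := (pt hL).
Local Notation annulus := (annulus pi iota v).
Local Notation std := (std_annulus iota v pi).

Lemma annulus_rad P a b x q : v x = rad q ->
  annulus P a b (pt x) <-> in_exponents P a b q.
Proof. by move=> xq; rewrite (annulusE pi hK hL) xq (in_annulusE hpi hL). Qed.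

Lemma annulus_exponent P a b x : annulus P a b (pt x) ->
  exists2 q, v x = rad q & in_exponents P a b q.
Proof. by move=> /(annulusE pi hK hL)/(in_annulus_exp hpi hK hL). Qed.

Lemma radii_in_annulus P a b : radii_in pi hL a b (annulus P a b).
Proof.
move=> x /annulus_exponent[q -> qP]; rewrite !(rad_le hpi hL).
by case: P qP => /=; lra.
Qed.

(** Through a point of exponent [q], the circle of exponent [q] cut by [|c| <= |g|] is a rational
    domain, with [q] as both of its bounds. *)
Lemma annulus_open_locus P a b (g : {poly K}) c : c != 0 ->
  admissible_open iota v (annulus P a b `&`
    cut_out iota (fun x => v (iota c) <= v (pval g x))).
Proof.
move=> c0 p; have [x <-] := pt_surj hL p.
have cutE y : cut_out iota (fun x => v (iota c) <= v (pval g x)) (pt y) <->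
    v (iota c) <= v (pval g y).
  apply: (@cut_outE _ _ _ _ _ _ hL (fun x => v (iota c) <= v (pval g x))).
  by move=> z t zt; rewrite (absval_pval_pt hK g zt).
move=> [/annulus_exponent[q xq qP] /cutE xg].
have [gh|Z Zr ZE] := @rational_annulus _ _ _ _ hpi hK _ _ _ hL q q [:: (c%:P, g)].
  by rewrite inE => /eqP -> /=; rewrite coprimep_sym coprimep_polyC.
exists Z; split=> //.
  move=> p'; have [y <-] := pt_surj hL p'; move=> /ZE[yq yg]; split.
    by rewrite (annulus_rad P a b (q := q)) //; apply: le_anti; rewrite andbC.
  by apply/cutE; have := yg (c%:P, g); rewrite inE eqxx pvalC; apply.
apply/ZE; split=> [|gh]; first by rewrite xq lexx.
by rewrite inE => /eqP -> /=; rewrite pvalC.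
Qed.

Lemma std_setT_open P a b : gopen (setT : set (std P a b)).
Proof.
rewrite /= /sub_open.
suff -> : @sub_image _ (annulus P a b) setT = annulus P a b `&`
    cut_out iota (fun x => v (iota 1) <= v (pval 1 x)).
  exact: annulus_open_locus (oner_neq0 _).
apply/seteqP; split=> [_ [p _ <-]|p [Ap _]].
  by split; [apply: svalP|move=> x _; rewrite pval1 rmorph1].
by exists (exist _ p Ap).
Qed.

Section Morphism.
Variables (P P' : annulus_type) (a b a' b' : rat).
Variable f : gmorphism (std P a b) (std P' a' b').

Let T : gopens (std P' a' b') := exist _ setT (@std_setT_open P' a' b').

Definition pull_coordinate : gsec (gpreim (@gfun_open _ _ _ f) T) :=
  gpull f T (poly_afun hK hL (sub_image (sval T)) 'X).

Lemma annulus_pull_domain :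
  annulus P a b `<=` sub_image (sval (gpreim (@gfun_open _ _ _ f) T)).
Proof. by move=> p Ap; exists (exist _ p Ap). Qed.

(** The restriction turns the section over the preimage of [T] into a function on [annulus P a b]
    itself. *)
Definition coordinate : afun iota v (annulus P a b) :=
  restr annulus_pull_domain pull_coordinate.

(** Pullback is a morphism of [K]-algebras, so it is determined on polynomials by the image of
    ['X]. *)
Lemma gpull_poly (W : gopens (std P' a' b')) (g : {poly K}) y :
  afun_val (gpull f W (poly_afun hK hL (sub_image (sval W)) g) : afun _ _ _) y =
  pval g
    (afun_val (gpull f W (poly_afun hK hL (sub_image (sval W)) 'X) : afun _ _ _) y).
Proof.
elim/poly_ind: g => [|g c IH].
  have -> : poly_afun hK hL (sub_image (sval W)) 0 = 0.
    by apply/val_inj/funext => z /=; rewrite pval0.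
  by rewrite rmorph0 pval0.
rewrite poly_afunMD pvalD pvalM pvalC pvalX -IH.
rewrite rmorphD rmorphM; congr (_ + _).
have -> : afun_cst iota v (sub_image (sval W)) c = gscal W c by [].
by rewrite gpull_scal.
Qed.

(* Were the minimal polynomial of the value of the coordinate nonzero at the
   image point, it would be invertible near that point, and its pullback would
   be a unit with a zero. *)
Lemma pt_coordinate (y : geom iota (annulus P a b)) (p : std P a b) :
  pt (sval y) = sval p -> pt (coordinate y) = sval (f p).
Proof.
move=> yp; set z := coordinate y; pose q := sval (pt z).
have [w wE] := pt_surj hL (sval (f p)); rewrite -wE; apply/pt_eqP; rewrite -/q.
apply: contrapT => /eqP qw.
have [e eE] := absval_rad hpi hK hL qw.
(* Rounding the exponent up gives [c] in [K] with [|c| <= |q(w)|], so the image point lies in the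
   open locus [|q| >= |c|], on which [q] is a unit. *)
have [c c0 cE] := base_rad hpi hL (Num.ceil e).
pose B := cut_out iota (fun x => v (iota c) <= v (pval q x)).
have BE x : B (pt x) <-> v (iota c) <= v (pval q x).
  apply: (@cut_outE _ _ _ _ _ _ hL (fun x => v (iota c) <= v (pval q x))).
  by move=> s t st; rewrite (absval_pval_pt hK q st).
pose W0 : set (std P' a' b') := [set u | B (sval u)].
have W0E : sub_image W0 = annulus P' a' b' `&` B.
  apply/seteqP; split=> [_ [u Bu <-]|u [Au Bu]]; first by split=> //; apply: svalP.
  by exists (exist _ u Au).
have W0o : gopen W0 by rewrite /= /sub_open W0E; apply: annulus_open_locus.
pose W : gopens (std P' a' b') := exist _ W0 W0o.
have low (u : geom iota (sub_image W0)) : v (iota c) <= v (pval q (sval u)).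
  case: u => u /= /[dup] /(lies_overE hL); rewrite W0E => -[_ Bu] _; exact/BE.
have vc0 : 0 < v (iota c) by rewrite absval_gt0 fmorph_eq0.
have [s' ss'] := poly_afun_unit hK hL vc0 low.
have yW : lies_over iota (sub_image (f @^-1` W0)) (sval y).
  apply/(lies_overE hL); exists p => //.
  rewrite /preimage /= /W0 /= -wE; apply/BE.
  by rewrite cE eE (rad_le hpi hL) ceil_ge.
pose y1 : geom iota (sub_image (sval (gpreim (@gfun_open _ _ _ f) W))) :=
  exist _ (sval y) yW.
have y1z : afun_val (gpull f W (poly_afun hK hL (sub_image W0) 'X) : afun _ _ _)
    y1 = z.
  have WT : sval W `<=` sval T by [].
  have -> : poly_afun hK hL (sub_image W0) 'X =
      gres WT (poly_afun hK hL (sub_image (sval T)) 'X : gsec T) :> gsec W.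
    exact/val_inj.
  rewrite gpull_res /z /coordinate /=; congr (afun_val _ _).
  exact: eq_exist.
have /(congr1 (fun t : afun iota v _ => afun_val t y1)) :
    gpull f W (poly_afun hK hL (sub_image W0) q : gsec W) * gpull f W s' = 1.
  by rewrite -rmorphM (ss' : _ = 1 :> gsec W) rmorph1.
rewrite -[LHS]/(
  afun_val (gpull f W (poly_afun hK hL (sub_image W0) q) : afun _ _ _) y1 * afun_val (gpull f W s' : afun _ _ _) y1).
rewrite gpull_poly y1z pt_root mul0r => /eqP.
by rewrite eq_sym oner_eq0.
Qed.

(** On the target the coordinate is bounded below by [rad b'], hence a unit; so is its pullback, to
    which [absval_unit] applies. *)
Lemma absval_morphism : a < b -> exists n m : int, forall (p : std P a b) x y q,
  pt x = sval p -> pt y = sval (f p) -> v x = rad q ->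
  v y = rad (n%:~R + m%:~R * q).
Proof.
move=> ab.
have low (u : geom iota (sub_image (sval T))) :
    rad b' <= v (pval 'X (sval u)).
  rewrite pvalX; have /(lies_overE hL)[[r Ar] _ /= rE] := svalP u.
  have := @radii_in_annulus P' a' b' (sval u).
  by rewrite -rE => /(_ Ar)/andP[].
have rad0 := rad_gt0 hpi hL b'.
have [X' XX'] := poly_afun_unit hK hL rad0 low.
pose C' : afun iota v (annulus P a b) :=
  restr annulus_pull_domain (gpull f T X').
have CC' : coordinate * C' = 1.
  have E : gpull f T (poly_afun hK hL (sub_image (sval T)) 'X) * gpull f T X' = 1.
    by rewrite -rmorphM (XX' : _ = 1 :> gsec T) rmorph1.
  have -> : coordinate * C' = restr annulus_pull_domain
      (pull_coordinate * gpull f T X') by apply/val_inj.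
  by rewrite /pull_coordinate E rmorph1.
have [|n [m nm]] := @absval_unit _ _ _ _ hpi hK _ _ _ hL P a b coordinate C' ab
  (elimT (asboolP _) (afun_analytic coordinate))
  (elimT (asboolP _) (afun_analytic C')).
  by move=> y; have := congr1 (fun t : afun _ _ _ => t y) CC'.
exists n, m => p x y q xp yp xq.
have xA : lies_over iota (annulus P a b) x.
  by apply/(lies_overE hL); rewrite xp; apply: svalP.
rewrite -(nm (exist _ x xA) q xq); apply: (absval_pt hK (hL := hL)).
by rewrite yp; apply/esym/pt_coordinate.
Qed.

End Morphism.

Lemma giso_exponents P a b a' b' : a < b -> giso (std P a b) (std P a' b') ->
  exists n m : int,
    (forall q, in_exponents P a b q ->
       in_exponents P a' b' (n%:~R + m%:~R * q)) /\
    (forall q', in_exponents P a' b' q' ->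
       exists2 q, in_exponents P a b q & q' = n%:~R + m%:~R * q).
Proof.
move=> ab [f [[g fK gK] _ _ _]]; have [n [m nm]] := absval_morphism f ab.
exists n, m; split=> [q qP|q' qP].
  have [x _ xq] := exists_rad hpi hL q.
  have xA : annulus P a b (pt x) by apply/annulus_rad/qP.
  have [y yE] := pt_surj hL (sval (f (exist _ _ xA))).
  apply/(annulus_rad _ _ _ (nm (exist _ _ xA) x y q erefl yE xq)).
  by rewrite yE; apply: svalP.
have [y _ yq] := exists_rad hpi hL q'.
have yA : annulus P a' b' (pt y) by apply/annulus_rad/qP.
pose p := g (exist _ _ yA); have [x xE] := pt_surj hL (sval p).
have [q xq qP'] : exists2 q, v x = rad q & in_exponents P a b q.
  by apply: annulus_exponent; rewrite xE; apply: svalP.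
exists q => //; apply: (rad_inj hpi hL); rewrite -yq.
by apply: (nm p x y q) => //; rewrite /p gK.
Qed.

End Rigidity.

(** * Exponents *)

(** The flags tell which ends belong to the interval. Unlike [in_exponents], this family is stable
    under [q |-> - q], which exchanges the flags. *)
Definition itv_exponents (l r : bool) (a b q : rat) : bool :=
  (if l then a <= q else a < q) && (if r then q <= b else q < b).

Lemma in_exponentsE P a b q : in_exponents P a b q =
  itv_exponents (if P is OpenAnnulus then false else true)
    (if P is ClosedAnnulus then true else false) a b q.
Proof. by case: P. Qed.

Lemma itv_exponents_opp l r a b q :
  itv_exponents l r a b q = itv_exponents r l (- b) (- a) (- q).
Proof.
by rewrite /itv_exponents andbC; case: l r => -[]; rewrite ?lerN2 ?ltrN2.
Qed.

Lemma itv_exponents_affine l r a b n m q : 0 < m ->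
  itv_exponents l r a b q =
  itv_exponents l r (n + m * a) (n + m * b) (n + m * q).
Proof.
move=> m0; rewrite /itv_exponents.
by case: l r => -[]; rewrite ?lerD2l ?ltrD2l ?ler_pM2l ?ltr_pM2l.
Qed.

Lemma itv_exponents_lower l r l' r' a b c d : a < b -> c < d ->
  (forall q, itv_exponents l r a b q -> itv_exponents l' r' c d q) -> c <= a.
Proof.
move=> ab cd sub; rewrite leNgt; apply/negP => ac.
(* If [a < c], this midpoint is strictly between [a] and [b] but below [c]. *)
have := sub ((a + Num.min b c) / 2); rewrite /itv_exponents.
by case: (leP b c) => bc; case: l l' r r' {sub} => -[] [] []; lra.
Qed.

Lemma itv_exponents_inj l r l' r' a b c d : a < b -> c < d ->
  (forall q, itv_exponents l r a b q = itv_exponents l' r' c d q) ->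
  [/\ a = c, b = d, l = l' & r = r'].
Proof.
move=> ab cd eqv.
have lower l1 r1 l2 r2 a1 b1 c1 d1 : a1 < b1 -> c1 < d1 ->
    (forall q, itv_exponents l1 r1 a1 b1 q = itv_exponents l2 r2 c1 d1 q) ->
    a1 = c1.
  move=> ab1 cd1 e; apply: le_anti; apply/andP; split.
    apply: (itv_exponents_lower (l := l2) (r := r2) cd1 ab1) => q.
    by rewrite -e => h; exact: h.
  apply: (itv_exponents_lower (l := l1) (r := r1) ab1 cd1) => q.
  by rewrite e => h; exact: h.
have ac := lower _ _ _ _ _ _ _ _ ab cd eqv.
(* Reflection turns upper ends into lower ones. *)
have bd : b = d.
  apply: oppr_inj; apply: (lower r l r' l' (- b) (- a) (- d) (- c)).
  - by rewrite ltrN2.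
  - by rewrite ltrN2.
  - by move=> q; rewrite -[q]opprK -!itv_exponents_opp.
subst c d; split=> //.
  have := eqv a; rewrite /itv_exponents !lexx !ltxx ab (ltW ab).
  by case: l l' r r' {eqv} => -[] [] [].
have := eqv b; rewrite /itv_exponents !lexx !ltxx ab (ltW ab).
by case: l l' r r' {eqv} => -[] [] [].
Qed.

(** The interval of exponents determines its ends and which of them it contains. For [m < 0] the
    ends are exchanged together with their flags, and a semi-open type has two different flags. *)
Lemma affine_exponents P a b a' b' (n m : rat) : a < b -> a' < b' ->
  (forall q, in_exponents P a b q -> in_exponents P a' b' (n + m * q)) ->
  (forall q', in_exponents P a' b' q' ->
     exists2 q, in_exponents P a b q & q' = n + m * q) ->
  [/\ 0 < m, a' = n + m * a & b' = n + m * b] \/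
  [/\ m < 0, P <> SemiOpenAnnulus, a' = n + m * b & b' = n + m * a].
Proof.
move=> ab a'b' fwd bwd.
pose l := if P is OpenAnnulus then false else true.
pose r := if P is ClosedAnnulus then true else false.
have m0 : m != 0.
  (* A constant map could not reach two distinct exponents. *)
  apply/eqP => m0; have [q1 [q2 [h1 h2]]] := in_exponents_two P a'b'.
  have [? _ ->] := bwd _ h1; have [? _ ->] := bwd _ h2.
  by rewrite m0 !mul0r ltxx.
have eqv q : in_exponents P a' b' (n + m * q) = in_exponents P a b q.
  apply/idP/idP => [/bwd[s sP /addrI/(mulfI m0) ->] //|]; exact: fwd.
have eqv' q : in_exponents P a' b' q = in_exponents P a b ((q - n) / m).
  by rewrite -eqv; congr in_exponents; field.
case: (ltgtP 0 m) m0 => // [m0|m0] _; [left|right].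
  have mab : n + m * a < n + m * b by rewrite ltrD2l ltr_pM2l.
  have [|-> -> //] := @itv_exponents_inj l r l r _ _ _ _ a'b' mab.
  move=> q; rewrite -in_exponentsE eqv' in_exponentsE.
  rewrite (itv_exponents_affine _ _ _ _ n _ m0); congr itv_exponents.
  by field; rewrite gt_eqF.
have mba : n + m * b < n + m * a by rewrite ltrD2l ltr_nM2l.
have [|-> -> lr _] := @itv_exponents_inj l r r l _ _ _ _ a'b' mba.
  move=> q; rewrite -in_exponentsE eqv' in_exponentsE itv_exponents_opp.
  have Nm : 0 < - m by rewrite oppr_gt0.
  rewrite (itv_exponents_affine _ _ _ _ n _ Nm).
  congr itv_exponents; first by ring.
  by ring.
  by field; rewrite lt_eqF.
by split=> // PS; move: lr; rewrite /l /r PS.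
Qed.

(** [flip] is the graph of an involution, so the equivalence it generates has classes of at most two
    elements. *)
Lemma clos_flipE x y : clos_refl_sym_trans _ flip x y <-> y = x \/ flip x y.
Proof.
have inv u w : flip u w -> flip w u.
  case: u w => [k s] [k' s'] [-> ->]; congr pair; rewrite /=.
  by rewrite opprB addrCA subrr addr0.
split=> [|[->|]]; [|exact: rst_refl|exact: rst_step].
elim=> [u w|u|u w _ [->|/inv]|u w t _ [->|uw] _ [->|wt]]; try by [left|right].
left; move: wt; rewrite /flip => ->; have := inv _ _ uw; rewrite /flip => E.
by rewrite -E.
Qed.

Lemma QmodZ_class_eq a b :
  QmodZ_class a = QmodZ_class b <-> exists n : int, a = n%:~R + b.
Proof.
split=> [/eqP|[n ->]].
  rewrite -Quotient.idealrBE => /intrP[n nE]; exists n.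
  by rewrite -nE subrK.
by apply/eqP; rewrite -Quotient.idealrBE addrK; apply/intrP; exists n.
Qed.

Lemma QmodZ_class_surj k : exists a, QmodZ_class a = k.
Proof. by exists (repr k); apply: reprK. Qed.

Lemma QmodZ_classN a : QmodZ_class (- a) = - QmodZ_class a.
Proof. by rewrite /QmodZ_class !piE. Qed.

Lemma QmodZ_classB a b : QmodZ_class (a - b) = QmodZ_class a - QmodZ_class b.
Proof. by rewrite /QmodZ_class !piE. Qed.

(** * Isomorphism classes *)

Section Classification.
Variables (R : realType) (K : fieldType) (vK : absval R K) (pi : K).
Hypotheses (hpi : is_uniformizer vK pi) (hK : complete_absval vK).
Variables (L : closedFieldType) (iota : {rmorphism K -> L}) (v : absval R L).
Hypothesis hL : is_valued_closure iota vK v.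
Local Notation rad := (Defs.radius iota v pi).
Local Notation pt := (pt hL).
Local Notation annulus := (annulus pi iota v).
Local Notation std := (std_annulus iota v pi).

Lemma annulus_inversion P a b c (n : int) (c0 : c != 0) :
  v (iota c) = rad n%:~R -> P <> SemiOpenAnnulus ->
  point_inversion hL c @^-1` annulus P a b = annulus P (n%:~R - b) (n%:~R - a).
Proof.
move=> cn PS; apply/seteqP; split=> p; have [x <-] := pt_surj hL p;
  rewrite /preimage /= (point_inversionE hL).
  move=> /(annulus_exponent hpi hK)[q xq qP].
  rewrite -[x](inversionK iota c0).
  apply/(annulus_rad hpi hK hL); first exact: (absval_inversion hpi hL cn xq).
  by case: P PS qP => //= _; lra.
move=> /(annulus_exponent hpi hK)[q xq qP].
apply/(annulus_rad hpi hK hL); first exact: (absval_inversion hpi hL cn xq).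
by case: P PS qP => //= _; lra.
Qed.

Lemma giso_flip P a b (n : int) : P <> SemiOpenAnnulus ->
  giso (std P (n%:~R - b) (n%:~R - a)) (std P a b).
Proof.
move=> PS; have [c c0 cn] := base_rad hpi hL n.
have := giso_inversion hpi hK c0 cn (@radii_in_annulus _ _ _ _ hpi hK _ _ _ hL P a b).
by rewrite (annulus_inversion _ _ c0 cn).
Qed.

(** Inversions by [c] of value [rad n%:~R] and by [d] of value [1] compose to the exponent map
    [q |-> n + q]. Two reflections restore the included ends, so this works for every type [P]. *)
Lemma giso_shift P a b (n : int) :
  giso (std P (a - n%:~R) (b - n%:~R)) (std P a b).
Proof.
have [c c0 cn] := base_rad hpi hL n; have [d d0 dn] := base_rad hpi hL 0.
have Sab := @radii_in_annulus _ _ _ _ hpi hK _ _ _ hL P a b.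
have S'ab := radii_in_inversion hpi hK c0 cn Sab.
apply: giso_trans (giso_inversion hpi hK c0 cn Sab).
have := giso_inversion hpi hK d0 dn S'ab; congr (giso (Defs.subspace _ _ _) _).
apply/seteqP; split=> p; have [x <-] := pt_surj hL p;
    rewrite /preimage /= !(point_inversionE hL).
  move=> /(annulus_exponent hpi hK)[q xq qP].
  rewrite -[x](inversionK iota d0) -[inversion iota d x](inversionK iota c0).
  have E := absval_inversion hpi hL dn (absval_inversion hpi hL cn xq).
  by apply/(annulus_rad hpi hK hL); [apply: E|move: qP; case: (P) => /=; lra].
move=> /(annulus_exponent hpi hK)[q xq qP].
have E := absval_inversion hpi hL cn (absval_inversion hpi hL dn xq).
by apply/(annulus_rad hpi hK hL); [apply: E|move: qP; case: (P) => /=; lra].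
Qed.

(** The exponent maps of an isomorphism and of its inverse have integer slopes [m] and [m'];
    comparing moduli forces [m = 1] or [m = -1]. In the second case [a' = n - b = n - (b - a) - a],
    which is the relation [flip] modulo integers. *)
Lemma giso_equiv P a b a' b' (h : a < b) (h' : a' < b') :
  giso (std P a b) (std P a' b') <->
  annulus_equiv P (modulus h, QmodZ_class a) (modulus h', QmodZ_class a').
Proof.
split=> [iso|].
  have [n [m [fwd bwd]]] := giso_exponents hpi hK hL h iso.
  have [n' [m' [fwd' bwd']]] := giso_exponents hpi hK hL h' (giso_sym iso).
  have abs1 (k k' : int) (d d' : rat) : 0 < d -> 0 < d' ->
      d' = k%:~R * d -> d = k'%:~R * d' -> 0 < k -> 0 < k' -> k = 1.
    move=> d0 d'0 E E' k0 k'0.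
    have kk : (k' * k)%:~R = 1 :> rat.
      by apply: (mulIf (lt0r_neq0 d0)); rewrite mul1r intrM -mulrA -E -E'.
    have {}kk : k' * k = 1 by apply/eqP; rewrite -(eqr_int rat) kk.
    by apply: le_anti; rewrite -[X in _ <= X]kk ler_peMl ?(ltW k0) //=.
  (* The four sign patterns reduce to positive slopes, where [abs1] uses [k' * k = 1]. *)
  have pos (k k' : int) (d d' : rat) : 0 < d -> 0 < d' ->
      (0 < k /\ d' = k%:~R * d) \/ (k < 0 /\ d' = - k%:~R * d) ->
      (0 < k' /\ d = k'%:~R * d') \/ (k' < 0 /\ d = - k'%:~R * d') ->
      k = 1 \/ k = - 1.
    move=> d0 d'0 [] [k0 E] [] [k'0 E'].
    - by left; apply: abs1 E E' _ _.
    - by left; apply: (abs1 k (- k') d d'); rewrite // ?rmorphN ?oppr_gt0.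
    - right; apply: oppr_inj; rewrite opprK.
      by apply: (abs1 (- k) k' d d'); rewrite // ?rmorphN ?oppr_gt0.
    - right; apply: oppr_inj; rewrite opprK.
      by apply: (abs1 (- k) (- k') d d'); rewrite // ?rmorphN ?oppr_gt0.
  have E := affine_exponents h h' fwd bwd.
  have E' := affine_exponents h' h fwd' bwd'.
  have [m1|m1] : m = 1 \/ m = -1.
    apply: (pos m m' (b - a) (b' - a')); rewrite ?subr_gt0 //.
      case: E => [[m0 -> ->]|[m0 _ -> ->]]; [left|right]; split;
        by [rewrite -(ltr_int rat)|ring].
    case: E' => [[m0 -> ->]|[m0 _ -> ->]]; [left|right]; split;
      by [rewrite -(ltr_int rat)|ring].
  - case: E => [[_ a'E b'E]|[]]; last by rewrite m1.
    suff -> : (modulus h', QmodZ_class a') = (modulus h, QmodZ_class a).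
      by case: P {iso fwd bwd fwd' bwd' E'} => /=; [apply: rst_refl| |apply: rst_refl].
    congr pair; first by apply: eq_exist; rewrite a'E b'E m1; ring.
    by apply/QmodZ_class_eq; exists n; rewrite a'E m1 mul1r.
  - case: E => [[]|[_ PS a'E b'E]]; first by rewrite m1.
    have F : flip (modulus h, QmodZ_class a) (modulus h', QmodZ_class a').
      rewrite /flip /=; congr pair.
        by apply: eq_exist; rewrite a'E b'E m1; ring.
      rewrite -[- QmodZ_class (b - a)]QmodZ_classN -QmodZ_classB.
      apply/QmodZ_class_eq; exists n.
      by rewrite a'E m1; ring.
    by case: P PS {iso fwd bwd fwd' bwd' E'} => //= _; apply: rst_step.
have eqP : (modulus h', QmodZ_class a') = (modulus h, QmodZ_class a) ->
    giso (std P a b) (std P a' b').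
  move=> [mod /QmodZ_class_eq[n nE]].
  have -> : a = a' - n%:~R by rewrite nE; ring.
  have -> : b = b' - n%:~R by rewrite -[b](subrK a) -mod nE; ring.
  exact: giso_shift.
have flipP : P <> SemiOpenAnnulus ->
    flip (modulus h, QmodZ_class a) (modulus h', QmodZ_class a') ->
    giso (std P a b) (std P a' b').
  move=> PS [mod].
  rewrite -[- QmodZ_class (b - a)]QmodZ_classN -QmodZ_classB => /QmodZ_class_eq[n nE].
  have -> : a = n%:~R - b' by rewrite -[b'](subrK a') mod nE; ring.
  have -> : b = n%:~R - a' by rewrite nE; ring.
  exact: giso_flip.
case: P eqP flipP => eP fP /=.
- by case/clos_flipE => [/eP|] //; apply: fP.
- by move=> E; apply: eP.
- by case/clos_flipE => [/eP|] //; apply: fP.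
Qed.

Lemma annulus_equiv_sym P s t : annulus_equiv P s t -> annulus_equiv P t s.
Proof. by case: P => /=; [apply: rst_sym|move=> ->|apply: rst_sym]. Qed.

Lemma annulus_equiv_trans P s t u :
  annulus_equiv P s t -> annulus_equiv P t u -> annulus_equiv P s u.
Proof. by case: P => /=; [apply: rst_trans|move=> ->|apply: rst_trans]. Qed.

Lemma annulus_equiv_refl P s : annulus_equiv P s s.
Proof. by case: P => //=; apply: rst_refl. Qed.

Lemma class_of_eq P s t :
  class_of (annulus_equiv P) s = class_of (annulus_equiv P) t <->
  annulus_equiv P s t.
Proof.
split=> [/(congr1 sval) /= E|st]; first by rewrite E; apply: annulus_equiv_refl.
apply: eq_exist; apply/funext => u; apply/propext; split.
  exact: annulus_equiv_trans (annulus_equiv_sym st).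
exact: annulus_equiv_trans.
Qed.

End Classification.

Theorem theorem7p4 (R : realType) (K : fieldType) (vK : absval R K) (pi : K)
    (hpi : is_uniformizer vK pi) (hK : complete_absval vK)
    (L : closedFieldType) (iota : {rmorphism K -> L}) (vL : absval R L)
    (hL : is_valued_closure iota vK vL) (P : annulus_type) :
  exists Phi : annulus_isoclass iota vL pi P -> quotient (annulus_equiv P),
    (forall (V : gspace K) (alpha beta : rat) (h : alpha < beta)
        (hV : is_annulus iota vL pi P alpha beta V),
       Phi (isoclass_of (ex_intro _ alpha (ex_intro _ beta hV))) =
       class_of (annulus_equiv P) (modulus h, QmodZ_class alpha)) /\
    bijective Phi.
Proof.
pose inv a b (h : a < b) : quotient (annulus_equiv P) :=
  class_of (annulus_equiv P) (modulus h, QmodZ_class a).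
(* One direction gives independence of the chosen representatives, the other injectivity. *)
have gisoE (V W : gspace K) a b a' b' (h : a < b) (h' : a' < b') :
    giso V (std_annulus iota vL pi P a b) ->
    giso W (std_annulus iota vL pi P a' b') ->
    giso V W <-> inv a b h = inv a' b' h'.
  move=> Va Wa; rewrite class_of_eq -(giso_equiv hpi hK hL); split=> iso.
    exact: giso_trans (giso_trans (giso_sym Va) iso) Wa.
  exact: giso_trans (giso_trans Va iso) (giso_sym Wa).
(* The specification ranges over all spaces representing [C] and all their radii, so the chosen
   value can be computed from any presentation. *)
have /choice[Phi PhiE] : forall C : annulus_isoclass iota vL pi P, exists w,
    forall V a b (h : a < b), giso V (std_annulus iota vL pi P a b) ->
      sval C = giso V -> w = inv a b h.
  move=> [C [V0 [[a0 [b0 [h0 V0a]]] CE]]]; exists (inv a0 b0 h0) => V a b h Va.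
  rewrite /= CE => VV; apply/(gisoE _ _ _ _ _ _ _ _ V0a Va).
  by rewrite VV; apply: giso_refl.
have inj : injective Phi.
  move=> [C1 [V1 [[a1 [b1 [h1 V1a]]] C1E]]] [C2 [V2 [[a2 [b2 [h2 V2a]]] C2E]]].
  rewrite (PhiE _ V1 a1 b1 h1) // (PhiE _ V2 a2 b2 h2) //.
  move=> /(gisoE _ _ _ _ _ _ _ _ V1a V2a) V12; apply: eq_exist.
  rewrite C1E C2E; apply/funext => W; apply/propext; split.
    exact: giso_trans (giso_sym V12).
  exact: giso_trans.
have surj w : exists C, Phi C = w.
  case: w => E [[[m m0] k] wE]; subst E; have [a ka] := QmodZ_class_surj k.
  subst k.
  (* A pair of modulus [m] and class of [a] is attained by the standard annulus with exponents [a]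
     and [a + m]. *)
  have h : a < a + m by rewrite ltrDl.
  have Va : is_annulus iota vL pi P a (a + m) (std_annulus iota vL pi P a (a + m)).
    by split=> //; apply: giso_refl.
  exists (isoclass_of (ex_intro _ a (ex_intro _ (a + m) Va))).
  rewrite (PhiE _ _ a (a + m) h Va.2) // /inv /class_of.
  suff -> : modulus h = exist _ m m0 by [].
  by apply: eq_exist; rewrite addrC addKr.
exists Phi; split=> [V a b h hV|]; first exact: PhiE hV.2 _.
have /choice[Psi PsiK] := surj.
by exists Psi => // C; apply: inj; rewrite PsiK.
Qed.
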